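(* Let $\mathbb K$ be a commutative semiring with $0\neq 1$ and let $S:\mathrm{NW}(\Delta)\to K$ be a nested word series. Then: (a) $S$ is regular iff $S$ is $\mathrm{sRMSO}(\mathbb K)$-definable iff $S$ is $\mathrm{sREMSO}(\mathbb K)$-definable. (b) If $\mathbb K$ is additively locally finite, then $S$ is regular iff $S$ is $\mathrm{swRMSO}(\mathbb K)$-definable. (c) If $\mathbb K$ is locally finite, then $S$ is regular iff $S$ is $\mathrm{MSO}(\mathbb K)$-definable. (All logics are over the signature of nested words.)
   Context: Nested words. Fix a finite alphabet $\Delta$; $[n]=\{1,\dots,n\}$. A nesting relation of width $n$ is a binary relation $\nu$ on $[n]$ such that: (1) $\nu(i,j)$ implies $i<j$; (2) $\nu(i,j),\nu(i,j')$ imply $j=j'$, and $\nu(i,j),\nu(i',j)$ imply $i=i'$; (3) $\nu(i,j),\nu(i',j')$ and $i<i'$ imply $j<i'$ or $j'<j$. A nested word is a pair $(w,\nu)$ with $w=a_1\cdots a_n\in\Delta^+$ and $\nu$ a nesting relation of width $n$; $\mathrm{NW}(\Delta)$ is the set of nested words. If $\nu(i,j)$, $i$ is a call position and $j$ a return position; all other positions are internal. Automata. $\mathbb K=(K,+,\cdot,0,1)$ is a commutative semiring. A weighted nested word automaton (WNWA) is $\mathcal A=(Q,\iota,\delta_{call},\delta_{int},\delta_{ret},\kappa)$ with $Q$ a finite set, $\delta_{call},\delta_{int}:Q\times\Delta\times Q\to K$, $\delta_{ret}:Q\times Q\times\Delta\times Q\to K$, $\iota,\kappa:Q\to K$. A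 run on $nw=(a_1\cdots a_n,\nu)$ is a state sequence $r=(q_0,\dots,q_n)$; its weight at position $j$ is $\delta_{call}(q_{j-1},a_j,q_j)$ if $j$ is a call position, $\delta_{int}(q_{j-1},a_j,q_j)$ if $j$ is internal, and $\delta_{ret}(q_{j-1},q_{i-1},a_j,q_j)$ if $\nu(i,j)$; $\mathrm{wt}(r)$ is the product of these over $j=1,\dots,n$. The behavior is $\|\mathcal A\|(nw)=\sum_{r=(q_0,\dots,q_n)}\iota(q_0)\,\mathrm{wt}(r)\,\kappa(q_n)$. A function $S:\mathrm{NW}(\Delta)\to K$ (nested word series) is regular if $S=\|\mathcal A\|$ for some WNWA $\mathcal A$. Logic. A nested word $(a_1\cdots a_n,\nu)$ is viewed as the structure with domain $[n]$, unary relations $\mathrm{Lab}_a=\{i:a_i=a\}$ ($a\in\Delta$), the natural order $\le$ and the binary relation $\nu$. Classical MSO formulas: $x=y$, $\mathrm{Lab}_a(x)$, $x\le y$, $\nu(x,y)$, $x\in X$, closed under $\vee,\neg,\exists x,\exists X$ (with the usual abbreviations $\wedge,\to,\leftrightarrow,\forall$, and $x<y:=\neg(y\le x)$). Weighted formulas $\mathrm{MSO}(\mathbb K)$ are given by: $k$ ($k\in K$), the atomic formulas $x=y,\mathrm{Lab}_a(x),x\le y,\nu(x,y),x\in X$ and their negations, and $\varphi\vee\psi$, $\varphi\wedge\psi$, $\exists x.\varphi$, $\exists X.\varphi$, $\forall x.\varphi$, $\forall X.\varphi$. For a structure $s$ and an assignment $\gamma$ of positions to first-order and subsets of the domain to second-order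 variables (defined on a finite set containing the free variables), the semantics $[\![\varphi]\!](s,\gamma)\in K$ is: $[\![k]\!]=k$; an atomic or negated atomic formula has value $1$ if it holds and $0$ otherwise; $\vee\mapsto +$, $\wedge\mapsto\cdot$; $\exists x$ (resp. $\exists X$) is the sum over all positions (resp. all subsets of the domain) of the value with $x$ (resp. $X$) so assigned; $\forall x$, $\forall X$ are the corresponding products. For a sentence $\varphi$, $[\![\varphi]\!]$ is a series $\mathrm{NW}(\Delta)\to K$; a series $S$ is $Z$-definable if $S=[\![\varphi]\!]$ for some sentence $\varphi\in Z$. To each classical formula $\varphi$ assign weighted formulas $\varphi^+,\varphi^-$: for atomic $\varphi$, $\varphi^+=\varphi$, $\varphi^-=\neg\varphi$; $(\neg\psi)^+=\psi^-$, $(\neg\psi)^-=\psi^+$; $(\psi\vee\psi')^+=\psi^+\vee(\psi^-\wedge\psi'^+)$, $(\psi\vee\psi')^-=\psi^-\wedge\psi'^-$; $(\exists x.\psi(x))^+=\exists x.(\psi(x)^+\wedge\forall y.(y<x\wedge\psi(y))^-)$, $(\exists x.\psi)^-=\forall x.\psi^-$; $(\exists X.\psi(X))^+=\exists X.(\psi(X)^+\wedge\forall Y.(Y<X\wedge\psi(Y))^-)$, $(\exists X.\psi)^-=\forall X.\psi^-$, where $Y<X$ is the classical formula $\exists y.(y\in X\wedge\neg y\in Y\wedge\forall z.(z<y\to(z\in X\leftrightarrow z\in Y)))$ (lexicographic order on sets). Formulas of the form $\varphi^+$ or $\varphi^-$ are syntactically unambiguous. $\mathrm{aUMSO}(\mathbb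 K)$ is the smallest set of weighted formulas containing all constants $k$ and all syntactically unambiguous formulas and closed under $\wedge,\vee$; $\mathrm{wUMSO}(\mathbb K)$ is the smallest such set closed additionally under $\exists x$ and $\exists X$. $\mathrm{sRMSO}(\mathbb K)$ consists of weighted formulas in which every subformula $\forall X.\psi$ has $\psi$ syntactically unambiguous and every subformula $\forall x.\psi$ has $\psi\in\mathrm{aUMSO}(\mathbb K)$; $\mathrm{swRMSO}(\mathbb K)$ is defined likewise with $\mathrm{wUMSO}(\mathbb K)$ in place of $\mathrm{aUMSO}(\mathbb K)$. $\mathrm{sRFO}(\mathbb K)$ consists of the $\mathrm{sRMSO}(\mathbb K)$ formulas without second-order quantification, and $\mathrm{sREMSO}(\mathbb K)$ of formulas $\exists X_1.\cdots\exists X_m.\psi$ with $\psi\in\mathrm{sRFO}(\mathbb K)$. $\mathbb K$ is additively locally finite if every finitely generated submonoid of $(K,+,0)$ is finite, and locally finite if every finitely generated subsemiring is finite. *)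

(* Defs.v *)
From mathcomp Require Import all_boot all_algebra.
Set Implicit Arguments. Unset Strict Implicit. Unset Printing Implicit Defensive.
Import GRing.Theory.

(* Nested words.  Positions are 0-based: the domain [n] = {1..n} of the
   paper is represented by 'I_n = {0..n-1} (order-preserving shift).   *)

Definition nesting_rel n (nu : {set 'I_n * 'I_n}) : bool :=
  [&& [forall i : 'I_n, forall j : 'I_n, ((i, j) \in nu) ==> (i < j)%N],
      [forall i : 'I_n, forall j : 'I_n, forall j' : 'I_n,
         ((i, j) \in nu) && ((i, j') \in nu) ==> (j == j')],
      [forall i : 'I_n, forall i' : 'I_n, forall j : 'I_n,
         ((i, j) \in nu) && ((i', j) \in nu) ==> (i == i')] &
      [forall i : 'I_n, forall j : 'I_n, forall i' : 'I_n, forall j' : 'I_n,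
         [&& (i, j) \in nu, (i', j') \in nu & (i < i')%N] ==>
           ((j < i')%N || (j' < j)%N)]].

Record nested_word (Delta : finType) := NestedWord {
  nw_len : nat;
  nw_word : nw_len.-tuple Delta;
  nw_nu : {set 'I_nw_len * 'I_nw_len};
  nw_pos : (0 < nw_len)%N;
  nw_nest : nesting_rel nw_nu }.

Section WNWA.
Variables (Delta : finType) (K : comPzSemiRingType) (Q : finType).
Variables (iota kappa : Q -> K) (dcall dint : Q -> Delta -> Q -> K)
          (dret : Q -> Q -> Delta -> Q -> K).

(* A run (q_0,...,q_n) is r : 'I_n.+1 -> Q.  For 0-based position p,
   the state before it is r p and after it r (p+1). *)
Definition pos_weight (nw : nested_word Delta)
    (r : {ffun 'I_(nw_len nw).+1 -> Q}) (p : 'I_(nw_len nw)) : K :=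
  let bef := fun i : 'I_(nw_len nw) => r (widen_ord (leqnSn _) i) in
  let aft := r (lift ord0 p) in
  let a := tnth (nw_word nw) p in
  match [pick i | (i, p) \in nw_nu nw] with
  | Some i => dret (bef p) (bef i) a aft
  | None => if [exists j, (p, j) \in nw_nu nw]
            then dcall (bef p) a aft
            else dint (bef p) a aft
  end.

Definition behavior (nw : nested_word Delta) : K :=
  (\sum_(r : {ffun 'I_(nw_len nw).+1 -> Q})
     ((iota (r ord0) * (\prod_(p < nw_len nw) pos_weight r p)) * kappa (r ord_max)))%R.
End WNWA.

Definition regular (Delta : finType) (K : comPzSemiRingType)
    (S : nested_word Delta -> K) : Prop :=
  exists (Q : finType) (iota : Q -> K) (dcall dint : Q -> Delta -> Q -> K)
         (dret : Q -> Q -> Delta -> Q -> K) (kappa : Q -> K),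
    forall nw, behavior iota kappa dcall dint dret nw = S nw.

(* Syntax.  First-order and second-order variables are natural numbers,
   in two separate name spaces.                                        *)

Inductive atom (Delta : Type) :=
| AEq of nat & nat
| ALab of Delta & nat
| ALe of nat & nat
| ANu of nat & nat
| AIn of nat & nat.

Inductive cform (Delta : Type) :=
| CAtom of atom Delta
| CNot of cform Delta
| COr of cform Delta & cform Delta
| CEx of nat & cform Delta
| CExS of nat & cform Delta.

Inductive wform (Delta K : Type) :=
| WConst of K
| WAtom of atom Delta
| WNAtom of atom Delta
| WOr of wform Delta K & wform Delta K
| WAnd of wform Delta K & wform Delta K
| WEx of nat & wform Delta K
| WExS of nat & wform Delta K
| WAll of nat & wform Delta K
| WAllS of nat & wform Delta K.

Arguments AEq {Delta}. Arguments ALab {Delta}. Arguments ALe {Delta}.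
Arguments ANu {Delta}. Arguments AIn {Delta}.
Arguments CAtom {Delta}. Arguments CNot {Delta}. Arguments COr {Delta}.
Arguments CEx {Delta}. Arguments CExS {Delta}.
Arguments WConst {Delta K}. Arguments WAtom {Delta K}. Arguments WNAtom {Delta K}.
Arguments WOr {Delta K}. Arguments WAnd {Delta K}. Arguments WEx {Delta K}.
Arguments WExS {Delta K}. Arguments WAll {Delta K}. Arguments WAllS {Delta K}.

Definition upd (T : Type) (g : nat -> T) (x : nat) (v : T) : nat -> T :=
  fun z => if z == x then v else g z.

Section Sem.
Variables (Delta : finType) (K : comPzSemiRingType) (nw : nested_word Delta).
Local Notation n := (nw_len nw).

Definition atom_holds (g1 : nat -> 'I_n) (g2 : nat -> {set 'I_n})
    (a : atom Delta) : bool :=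
  match a with
  | AEq x y => g1 x == g1 y
  | ALab c x => tnth (nw_word nw) (g1 x) == c
  | ALe x y => (g1 x <= g1 y)%N
  | ANu x y => (g1 x, g1 y) \in nw_nu nw
  | AIn x X => g1 x \in g2 X
  end.

Fixpoint wsem (g1 : nat -> 'I_n) (g2 : nat -> {set 'I_n})
    (phi : wform Delta K) : K :=
  match phi with
  | WConst k => k
  | WAtom a => if atom_holds g1 g2 a then 1%R else 0%R
  | WNAtom a => if atom_holds g1 g2 a then 0%R else 1%R
  | WOr a b => (wsem g1 g2 a + wsem g1 g2 b)%R
  | WAnd a b => (wsem g1 g2 a * wsem g1 g2 b)%R
  | WEx x a => (\sum_(i : 'I_n) wsem (upd g1 x i) g2 a)%R
  | WExS X a => (\sum_(A : {set 'I_n}) wsem g1 (upd g2 X A) a)%R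
  | WAll x a => (\prod_(i : 'I_n) wsem (upd g1 x i) g2 a)%R
  | WAllS X a => (\prod_(A : {set 'I_n}) wsem g1 (upd g2 X A) a)%R
  end.

(* semantics of a sentence: the assignment is irrelevant; we use a fixed one *)
Definition sentence_sem (phi : wform Delta K) : K :=
  wsem (fun _ => Ordinal (nw_pos nw)) (fun _ => set0) phi.
End Sem.

Definition atom_fv1 Delta (a : atom Delta) : seq nat :=
  match a with
  | AEq x y | ALe x y | ANu x y => [:: x; y]
  | ALab _ x | AIn x _ => [:: x]
  end.
Definition atom_fv2 Delta (a : atom Delta) : seq nat :=
  match a with AIn _ X => [:: X] | _ => [::] end.

Fixpoint wfv1 Delta K (phi : wform Delta K) : seq nat :=
  match phi with
  | WConst _ => [::]
  | WAtom a | WNAtom a => atom_fv1 a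
  | WOr a b | WAnd a b => wfv1 a ++ wfv1 b
  | WEx x a | WAll x a => filter (predC1 x) (wfv1 a)
  | WExS _ a | WAllS _ a => wfv1 a
  end.
Fixpoint wfv2 Delta K (phi : wform Delta K) : seq nat :=
  match phi with
  | WConst _ => [::]
  | WAtom a | WNAtom a => atom_fv2 a
  | WOr a b | WAnd a b => wfv2 a ++ wfv2 b
  | WEx _ a | WAll _ a => wfv2 a
  | WExS X a | WAllS X a => filter (predC1 X) (wfv2 a)
  end.

Definition sentence Delta K (phi : wform Delta K) : Prop :=
  wfv1 phi = [::] /\ wfv2 phi = [::].

Section Classical.
Variable Delta : Type.
Local Notation cf := (cform Delta).

Definition cand (a b : cf) : cf := CNot (COr (CNot a) (CNot b)).
Definition cimp (a b : cf) : cf := COr (CNot a) b.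
Definition ciff (a b : cf) : cf := cand (cimp a b) (cimp b a).
Definition call (x : nat) (a : cf) : cf := CNot (CEx x (CNot a)).
Definition clt (x y : nat) : cf := CNot (CAtom (ALe y x)).
Definition cltS (Y X : nat) : cf :=
  CEx 0 (cand (CAtom (AIn 0 X))
         (cand (CNot (CAtom (AIn 0 Y)))
               (call 1 (cimp (clt 1 0)
                          (ciff (CAtom (AIn 1 X)) (CAtom (AIn 1 Y))))))).

Definition atom_vars1 (a : atom Delta) : seq nat := atom_fv1 a.
Definition atom_vars2 (a : atom Delta) : seq nat := atom_fv2 a.

Fixpoint cvars1 (phi : cf) : seq nat :=
  match phi with
  | CAtom a => atom_vars1 a
  | CNot a => cvars1 a
  | COr a b => cvars1 a ++ cvars1 b
  | CEx x a => x :: cvars1 a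
  | CExS _ a => cvars1 a
  end.
Fixpoint cvars2 (phi : cf) : seq nat :=
  match phi with
  | CAtom a => atom_vars2 a
  | CNot a => cvars2 a
  | COr a b => cvars2 a ++ cvars2 b
  | CEx _ a => cvars2 a
  | CExS X a => X :: cvars2 a
  end.

Definition fresh1 (x : nat) (phi : cf) : nat := (foldr maxn x (cvars1 phi)).+1.
Definition fresh2 (X : nat) (phi : cf) : nat := (foldr maxn X (cvars2 phi)).+1.

Definition ren (x y u : nat) : nat := if u == x then y else u.

Definition atom_ren1 (x y : nat) (a : atom Delta) : atom Delta :=
  match a with
  | AEq u v => AEq (ren x y u) (ren x y v)
  | ALab c u => ALab c (ren x y u)
  | ALe u v => ALe (ren x y u) (ren x y v)
  | ANu u v => ANu (ren x y u) (ren x y v)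
  | AIn u X => AIn (ren x y u) X
  end.
Definition atom_ren2 (X Y : nat) (a : atom Delta) : atom Delta :=
  match a with
  | AIn u Z => AIn u (ren X Y Z)
  | a => a
  end.

(* substitution of the (fresh) variable y for the free occurrences of x *)
Fixpoint crename1 (x y : nat) (phi : cf) : cf :=
  match phi with
  | CAtom a => CAtom (atom_ren1 x y a)
  | CNot a => CNot (crename1 x y a)
  | COr a b => COr (crename1 x y a) (crename1 x y b)
  | CEx z a => if z == x then CEx z a else CEx z (crename1 x y a)
  | CExS Z a => CExS Z (crename1 x y a)
  end.
Fixpoint crename2 (X Y : nat) (phi : cf) : cf :=
  match phi with
  | CAtom a => CAtom (atom_ren2 X Y a)
  | CNot a => CNot (crename2 X Y a)
  | COr a b => COr (crename2 X Y a) (crename2 X Y b)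
  | CEx z a => CEx z (crename2 X Y a)
  | CExS Z a => if Z == X then CExS Z a else CExS Z (crename2 X Y a)
  end.
End Classical.
Arguments clt {Delta}. Arguments cltS {Delta}.

(* The translation phi |-> (phi^+, phi^-), as an (inductive, functional)
   graph relation:  pm phi p m  <->  phi^+ = p /\ phi^- = m.          *)

Section Fragments.
Variables (Delta K : Type).
Local Notation wf := (wform Delta K).

Inductive pm : cform Delta -> wf -> wf -> Prop :=
| pm_atom a : pm (CAtom a) (WAtom a) (WNAtom a)
| pm_not phi p m : pm phi p m -> pm (CNot phi) m p
| pm_or phi psi p m p' m' :
    pm phi p m -> pm psi p' m' ->
    pm (COr phi psi) (WOr p (WAnd m p')) (WAnd m m')
| pm_ex x phi p m p2 m2 :
    pm phi p m ->
    pm (cand (clt (fresh1 x phi) x) (crename1 x (fresh1 x phi) phi)) p2 m2 ->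
    pm (CEx x phi) (WEx x (WAnd p (WAll (fresh1 x phi) m2))) (WAll x m)
| pm_exS X phi p m p2 m2 :
    pm phi p m ->
    pm (cand (cltS (fresh2 X phi) X) (crename2 X (fresh2 X phi) phi)) p2 m2 ->
    pm (CExS X phi) (WExS X (WAnd p (WAllS (fresh2 X phi) m2))) (WAllS X m).

Definition syn_unamb (phi : wf) : Prop :=
  exists c p m, pm c p m /\ (phi = p \/ phi = m).

Inductive aUMSO : wf -> Prop :=
| aU_const k : aUMSO (WConst k)
| aU_su phi : syn_unamb phi -> aUMSO phi
| aU_and a b : aUMSO a -> aUMSO b -> aUMSO (WAnd a b)
| aU_or a b : aUMSO a -> aUMSO b -> aUMSO (WOr a b).

Inductive wUMSO : wf -> Prop :=
| wU_const k : wUMSO (WConst k)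
| wU_su phi : syn_unamb phi -> wUMSO phi
| wU_and a b : wUMSO a -> wUMSO b -> wUMSO (WAnd a b)
| wU_or a b : wUMSO a -> wUMSO b -> wUMSO (WOr a b)
| wU_ex x a : wUMSO a -> wUMSO (WEx x a)
| wU_exS X a : wUMSO a -> wUMSO (WExS X a).

Fixpoint restricted (P : wf -> Prop) (phi : wf) : Prop :=
  match phi with
  | WOr a b | WAnd a b => restricted P a /\ restricted P b
  | WEx _ a | WExS _ a => restricted P a
  | WAll _ a => P a /\ restricted P a
  | WAllS _ a => syn_unamb a /\ restricted P a
  | _ => True
  end.

Definition sRMSO (phi : wf) : Prop := restricted aUMSO phi.
Definition swRMSO (phi : wf) : Prop := restricted wUMSO phi.

Fixpoint no_SO (phi : wf) : bool :=
  match phi with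
  | WOr a b | WAnd a b => no_SO a && no_SO b
  | WEx _ a | WAll _ a => no_SO a
  | WExS _ _ | WAllS _ _ => false
  | _ => true
  end.

Definition sRFO (phi : wf) : Prop := sRMSO phi /\ no_SO phi.
Definition sREMSO (phi : wf) : Prop :=
  exists (Xs : seq nat) (psi : wf), sRFO psi /\ phi = foldr WExS psi Xs.
Definition MSO (phi : wf) : Prop := True.
End Fragments.

Definition definable (Delta : finType) (K : comPzSemiRingType)
    (Z : wform Delta K -> Prop) (S : nested_word Delta -> K) : Prop :=
  exists phi, [/\ Z phi, sentence phi & forall nw, sentence_sem nw phi = S nw].

(* Local finiteness: the submonoid (resp. subsemiring) generated by any
   finite set is contained in a finite set closed under the operations,
   i.e. is finite.                                                     *)

Definition add_loc_finite (K : comPzSemiRingType) : Prop :=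
  forall s : seq K, exists t : seq K,
    [/\ {subset s <= t}, (0%R \in t) & {in t &, forall a b, (a + b)%R \in t}].

Definition loc_finite (K : comPzSemiRingType) : Prop :=
  forall s : seq K, exists t : seq K,
    [/\ {subset s <= t}, (0%R \in t), (1%R \in t),
        {in t &, forall a b, (a + b)%R \in t} &
        {in t &, forall a b, (a * b)%R \in t}].

(* Main.v *)
(* A nested word series is regular as soon as it is a function of the final
   state of a deterministic automaton whose state after a call depends on the
   letter read only.  On such an automaton the levels of nesting evolve
   independently, so the number of ways to mark positions that lead to a given
   configuration is a product over the pending levels; these counts, taken
   modulo a threshold and a period, are again computed by such an automaton.
   This one construction replaces determinisation: it yields Boolean
   quantification, and, when the sums (and products) of the values are eventually
   periodic, weighted quantification.  Weighted automata are closed under sum,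
   product and projection, and the product over all positions of a
   finite-state series is obtained by guessing, checking and then projecting
   away the state reached for each position.
   Conversely, a run is described by one set variable per state; an assignment
   putting a position in no or in several states has weight 0, and the state
   after the last position is chosen by a finite disjunction. *)

From HB Require Import structures.
Require Import Defs.
From mathcomp Require Import all_boot all_algebra.
From mathcomp Require Import zify.
Set Implicit Arguments. Unset Strict Implicit. Unset Printing Implicit Defensive.
Import GRing.Theory.

(** * Nesting structure and restarting automata *)

(** Why automata restart: if the state after a call depended on the state before it, the markings of
    the outer and of the inner level would be correlated, and their number would not be a product.
    What an inner level would need to know of its context is instead computed for every context and
    resolved at the return, as [finrec_word] does with transformations of states. Why counting: an
    aggregate over all markings depends only on how often each final state occurs. Hence one
    construction covers every commutative operation whose iterates are eventually periodic:
    disjunction and conjunction always, addition and multiplication of [K] under the local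
    finiteness assumptions. Over a general [K] sums and products may leave the finite-state series,
    and weighted automata take over. These have no general closure under products over positions,
    and the fragments are cut so that the body of every such product is finite-state. *)

Section Nesting.
Variables (n : nat) (nu : {set 'I_n * 'I_n}).
Hypothesis nest : nesting_rel nu.

Lemma nest_lt i j : (i, j) \in nu -> i < j.
Proof. by case/and4P: nest => /'forall_'forall_implyP h _ _ _; apply: h. Qed.

Lemma nest_funl i i' j : (i, j) \in nu -> (i', j) \in nu -> i = i'.
Proof.
case/and4P: nest => _ _ h _ ij i'j.
move/forallP/(_ i)/forallP/(_ i')/forallP/(_ j)/implyP: h.
by rewrite ij i'j => /(_ isT)/eqP.
Qed.

Lemma nest_funr i j j' : (i, j) \in nu -> (i, j') \in nu -> j = j'.
Proof.
case/and4P: nest => _ h _ _ ij ij'.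
move/forallP/(_ i)/forallP/(_ j)/forallP/(_ j')/implyP: h.
by rewrite ij ij' => /(_ isT)/eqP.
Qed.

Lemma nest_cross i j i' j' :
  (i, j) \in nu -> (i', j') \in nu -> i < i' -> (j < i') || (j' < j).
Proof.
case/and4P: nest => _ _ _ h ij i'j' lt_ii'.
move/forallP/(_ i)/forallP/(_ j)/forallP/(_ i')/forallP/(_ j')/implyP: h.
by apply; rewrite ij i'j'.
Qed.

Lemma nest_not_call_ret i j k : (i, j) \in nu -> (j, k) \in nu -> False.
Proof.
move=> ij jk; have lt_ij := nest_lt ij; have lt_jk := nest_lt jk.
by case/orP: (nest_cross ij jk lt_ij); rewrite ?ltnn // ltnNge (ltnW lt_jk).
Qed.
End Nesting.

Inductive ptag := Call | Int | Ret.

Lemma ptag_comparable : comparable ptag.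
Proof. by move=> x y; rewrite /decidable; decide equality. Qed.

HB.instance Definition _ := comparableMixin ptag_comparable.

Section Tags.
Variables (n : nat) (nu : {set 'I_n * 'I_n}).

Definition tagof (p : 'I_n) : ptag :=
  if [exists i, (i, p) \in nu] then Ret
  else if [exists j, (p, j) \in nu] then Call else Int.

(* The call positions before [p] whose return is not before [p], innermost first. *)
Definition open_calls (p : nat) : seq 'I_n :=
  rev [seq i : 'I_n <- enum 'I_n | (i < p) && [exists j, ((i, j) \in nu) && (p <= j)]].

Lemma sorted_enum_ord : sorted (fun i j : 'I_n => i < j) (enum 'I_n).
Proof. by have := iota_ltn_sorted 0 n; rewrite -val_enum_ord sorted_map. Qed.

Lemma mem_open_calls p i :
  (i \in open_calls p) = (i < p) && [exists j, ((i, j) \in nu) && (p <= j)].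
Proof. by rewrite mem_rev mem_filter mem_enum andbT. Qed.

Lemma sorted_open_calls p : sorted (fun i j : 'I_n => j < i) (open_calls p).
Proof.
rewrite /open_calls rev_sorted; apply: sorted_filter sorted_enum_ord.
by move=> ? ? ?; apply: ltn_trans.
Qed.

(** A strictly decreasing list is determined by its members, so the effect of a position on the
    pending calls reduces to a comparison of memberships. *)
Lemma open_calls_eq p s :
  sorted (fun i j : 'I_n => j < i) s -> open_calls p =i s -> open_calls p = s.
Proof.
move=> ss; apply: (irr_sorted_eq _ _ (sorted_open_calls p) ss).
- by move=> a b c /= ab bc; apply: ltn_trans bc ab.
- by move=> a /=; rewrite ltnn.
Qed.

Lemma open_calls0 : open_calls 0 = [::].
Proof. by apply: open_calls_eq => // i; rewrite mem_open_calls. Qed.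

Lemma open_callsn : open_calls n = [::].
Proof.
apply: open_calls_eq => // i; rewrite mem_open_calls in_nil.
apply/negbTE; apply/negP => /andP[_ /existsP[j /andP[_]]].
by rewrite leqNgt ltn_ord.
Qed.

Hypothesis nest : nesting_rel nu.

Let gt_trans : transitive (fun i j : 'I_n => j < i).
Proof. by move=> a b c /= ab bc; apply: ltn_trans bc ab. Qed.

Lemma open_calls_ret (i0 p : 'I_n) : (i0, p) \in nu ->
  open_calls p = i0 :: open_calls p.+1.
Proof.
move=> ip; have lt_ip := nest_lt nest ip.
(* Non-crossing makes [i0] the innermost pending call: a call opened after [i0] and before [p] has
   returned before [p]. *)
have key i j : (i, j) \in nu -> i < p -> p <= j -> i <= i0.
  move=> ij ltip lepj; rewrite leqNgt; apply/negP => lt_i0i.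
  case/orP: (nest_cross nest ip ij lt_i0i); first by rewrite ltnNge ltnW.
  by rewrite ltnNge lepj.
have inS i : (i \in open_calls p.+1) = (i \in open_calls p) && (i != i0).
  rewrite !mem_open_calls; apply/idP/idP.
    case/andP=> lt_ip1 /existsP[j /andP[ij ltpj]].
    have ne_ip : i != p :> nat.
      by apply/eqP => /val_inj ei; move: ij; rewrite ei => /(nest_not_call_ret nest ip).
    rewrite ltn_neqAle ne_ip -ltnS lt_ip1 /=; apply/andP; split.
      by apply/existsP; exists j; rewrite ij ltnW.
    apply/eqP => ei; rewrite ei in ij.
    have := nest_funr nest ip ij => ej; by rewrite ej ltnn in ltpj.
  case/andP=> /andP[lt_ip' /existsP[j /andP[ij lepj]]] ne; rewrite ltnW //=.
  apply/existsP; exists j; rewrite ij ltn_neqAle lepj andbT /=.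
  apply/eqP => /val_inj ej; rewrite -ej in ij.
  by rewrite (nest_funl nest ij ip) eqxx in ne.
apply: open_calls_eq.
  rewrite /= path_sortedE // sorted_open_calls andbT; apply/allP => i.
  rewrite inS mem_open_calls => /andP[/andP[lip /existsP[j /andP[ij lepj]]]] ne.
  by rewrite ltn_neqAle (key _ _ ij) // andbT.
move=> i; rewrite inE inS; case: eqP => [->|] /=; last by rewrite andbT.
by rewrite mem_open_calls lt_ip; apply/existsP; exists p; rewrite ip leqnn.
Qed.

Lemma open_calls_call (p j : 'I_n) : (p, j) \in nu ->
  open_calls p.+1 = p :: open_calls p.
Proof.
move=> pj; have lt_pj := nest_lt nest pj.
apply: open_calls_eq.
  rewrite /= path_sortedE // sorted_open_calls andbT; apply/allP => i.
  by rewrite mem_open_calls => /andP[].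
move=> i; rewrite inE !mem_open_calls ltnS leq_eqVlt.
case: (eqVneq i p) => [->|ne] /=.
  by rewrite eqxx; apply/existsP; exists j; rewrite pj.
have -> /= : (val i == val p) = false by apply/negbTE.
congr (_ && _); apply/eq_existsb => k; case ik: ((i, k) \in nu) => //=.
rewrite ltn_neqAle; case: eqP => //= /val_inj ek.
by rewrite -ek in ik; case: (nest_not_call_ret nest ik pj).
Qed.

Lemma open_calls_int (p : 'I_n) :
  ~~ [exists i, (i, p) \in nu] -> ~~ [exists j, (p, j) \in nu] ->
  open_calls p.+1 = open_calls p.
Proof.
move=> /existsPn nr /existsPn nc; apply: open_calls_eq; first exact: sorted_open_calls.
move=> i; rewrite !mem_open_calls ltnS leq_eqVlt.
case: (eqVneq i p) => [->|ne] /=.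
  by rewrite eqxx ltnn; apply/existsP => -[k]; rewrite (negbTE (nc _)).
have -> /= : (val i == val p) = false by apply/negbTE.
congr (_ && _); apply/eq_existsb => k; case ik: ((i, k) \in nu) => //=.
rewrite ltn_neqAle; case: eqP => //= /val_inj ek.
by rewrite -ek (negbTE (nr _)) in ik.
Qed.
End Tags.

Section TaggedWords.
Variables (Sigma : Type) (n : nat) (nu : {set 'I_n * 'I_n}) (l : 'I_n -> Sigma).

(* Tagged words list their latest letter first. *)
Definition tprefix (p : nat) : seq (ptag * Sigma) :=
  rev [seq (tagof nu i, l i) | i <- take p (enum 'I_n)].

Definition tword : seq (ptag * Sigma) := rev [seq (tagof nu i, l i) | i <- enum 'I_n].

Lemma tprefix0 : tprefix 0 = [::].
Proof. by rewrite /tprefix take0. Qed.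

Lemma tprefixS (p : 'I_n) : tprefix p.+1 = (tagof nu p, l p) :: tprefix p.
Proof.
rewrite /tprefix (take_nth p) ?size_enum_ord // map_rcons rev_rcons.
by rewrite nth_ord_enum.
Qed.

Lemma tprefixn : tprefix n = tword.
Proof. by rewrite /tprefix take_oversize // size_enum_ord. Qed.
End TaggedWords.

(** [d] is the number of pending calls at the end of the word. As the latest letter comes first, the
    recursion undoes letters: removing a call lowers [d], removing a return raises it. *)
Fixpoint well_matched (Sigma : Type) (w : seq (ptag * Sigma)) (d : nat) : bool :=
  match w with
  | [::] => d == 0
  | (Call, _) :: w' => if d is d'.+1 then well_matched w' d' else false
  | (Int, _) :: w' => well_matched w' d
  | (Ret, _) :: w' => well_matched w' d.+1
  end.

Lemma well_matched_tprefix Sigma n (nu : {set 'I_n * 'I_n}) (l : 'I_n -> Sigma) p :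
  nesting_rel nu -> p <= n -> well_matched (tprefix nu l p) (size (open_calls nu p)).
Proof.
move=> nest; elim: p => [|p IH] ltpn; first by rewrite tprefix0 open_calls0.
rewrite -[p]/(val (Ordinal ltpn)) tprefixS /tagof; set o := Ordinal ltpn.
have {IH} := IH (ltnW ltpn); rewrite -[p]/(val o).
case: ifPn => [/existsP[i ip]|nr]; first by rewrite (open_calls_ret nest ip).
case: ifPn => [/existsP[j pj]|nc]; first by rewrite (open_calls_call nest pj).
by rewrite (open_calls_int nr nc).
Qed.

Lemma well_matched_tword Sigma n (nu : {set 'I_n * 'I_n}) (l : 'I_n -> Sigma) :
  nesting_rel nu -> well_matched (tword nu l) 0.
Proof.
by move=> nest; have := well_matched_tprefix l nest (leqnn n); rewrite tprefixn open_callsn.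
Qed.

(* Deterministic automata that restart at every call: the state after a call
   depends on the letter read only, the state before the call being
   available again at the matching return. *)
Record rdnwa (Sigma : Type) := RDNWA {
  rstate : finType;
  rinit : rstate;
  rcall : Sigma -> rstate;
  rint : rstate -> Sigma -> rstate;
  rret : rstate -> rstate -> Sigma -> rstate }.

Section Config.
Variables (Sigma : Type) (D : rdnwa Sigma).

(** The last case is a default for stacks too short for the letter; [size_config] excludes it on
    well-matched words. *)
Definition rstep (x : ptag * Sigma) (c : seq (rstate D)) : seq (rstate D) :=
  match x.1, c with
  | Call, _ => rcall D x.2 :: c
  | Int, q :: c' => rint q x.2 :: c'
  | Ret, q1 :: q0 :: c' => rret q1 q0 x.2 :: c'
  | _, _ => c
  end.

(* The current state, followed by the states before the pending calls. *)
Definition config (w : seq (ptag * Sigma)) : seq (rstate D) := foldr rstep [:: rinit D] w.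

Lemma size_config w d : well_matched w d -> size (config w) = d.+1.
Proof.
elim: w d => [|[[] a] w IH] d /=; first by move/eqP->.
- by case: d => // d /IH /= ->.
- by move/IH; rewrite -/(config w) /rstep /=; case: (config w).
- by move/IH; rewrite -/(config w) /rstep /=; case: (config w) => [|q [|q1 c]] //= []->.
Qed.

Definition rrun n (nu : {set 'I_n * 'I_n}) (l : 'I_n -> Sigma) : rstate D :=
  head (rinit D) (config (tword nu l)).

Lemma config_tword n (nu : {set 'I_n * 'I_n}) (l : 'I_n -> Sigma) :
  nesting_rel nu -> config (tword nu l) = [:: rrun nu l].
Proof.
move=> nest; have := size_config (well_matched_tword l nest).
by rewrite /rrun; case: (config _) => [|q []].
Qed.

Section Run.
Variables (n : nat) (nu : {set 'I_n * 'I_n}) (l : 'I_n -> Sigma).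
Hypothesis nest : nesting_rel nu.

Definition rstate_at (p : nat) := head (rinit D) (config (tprefix nu l p)).

(** Ties the stack, which only sees tags, to [nu]: at a return its second entry is the state before
    the matching call. *)
Lemma config_tprefix p : p <= n ->
  config (tprefix nu l p) = rstate_at p :: [seq rstate_at i | i : 'I_n <- open_calls nu p].
Proof.
elim: p => [|p IH] ltpn; first by rewrite /rstate_at tprefix0 open_calls0.
set o := Ordinal ltpn; have {IH} := IH (ltnW ltpn).
rewrite /(rstate_at p.+1) -[p]/(val o) tprefixS /= => ->.
rewrite /tagof.
case: ifPn => [/existsP[i ip]|nr]; first by rewrite (open_calls_ret nest ip).
case: ifPn => [/existsP[j pj]|nc]; first by rewrite (open_calls_call nest pj).
by rewrite (open_calls_int nr nc).
Qed.

Lemma rstate_at0 : rstate_at 0 = rinit D.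
Proof. by rewrite /rstate_at tprefix0. Qed.

Lemma rstate_atn : rstate_at n = rrun nu l.
Proof. by rewrite /rstate_at tprefixn. Qed.

Lemma rstate_at_ret (i p : 'I_n) : (i, p) \in nu ->
  rstate_at p.+1 = rret (rstate_at p) (rstate_at i) (l p).
Proof.
move=> ip; rewrite {1}/rstate_at tprefixS /= config_tprefix ?(ltnW (ltn_ord p)) //.
rewrite (open_calls_ret nest ip) /tagof ifT //; by apply/existsP; exists i.
Qed.

Lemma rstate_at_call (p j : 'I_n) : (p, j) \in nu ->
  rstate_at p.+1 = rcall D (l p).
Proof.
move=> pj; rewrite {1}/rstate_at tprefixS /= config_tprefix ?(ltnW (ltn_ord p)) //.
rewrite /tagof ifF; last by apply/existsP => -[i /(nest_not_call_ret nest)/(_ pj)].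
by rewrite ifT //; apply/existsP; exists j.
Qed.

Lemma rstate_at_int (p : 'I_n) :
  ~~ [exists i, (i, p) \in nu] -> ~~ [exists j, (p, j) \in nu] ->
  rstate_at p.+1 = rint (rstate_at p) (l p).
Proof.
move=> nr nc; rewrite {1}/rstate_at tprefixS /= config_tprefix ?(ltnW (ltn_ord p)) //.
by rewrite /tagof (negbTE nr) (negbTE nc).
Qed.
End Run.
End Config.

(** * Finite-state series *)

(** Letters are a labelling separate from the nested domain, so marking positions changes the
    alphabet and leaves [n] and [nu] alone. *)
Definition nseries (Sigma V : Type) :=
  forall n, {set 'I_n * 'I_n} -> ('I_n -> Sigma) -> V.

Definition finrec (Sigma V : Type) (S : nseries Sigma V) : Prop :=
  exists (D : rdnwa Sigma) (f : rstate D -> V),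
    forall n (nu : {set 'I_n * 'I_n}) l, nesting_rel nu -> S n nu l = f (rrun D nu l).

Lemma finrec_const (Sigma V : Type) (v : V) :
  finrec (fun n (nu : {set 'I_n * 'I_n}) (l : 'I_n -> Sigma) => v).
Proof.
by exists (@RDNWA Sigma unit tt (fun=> tt) (fun _ _ => tt) (fun _ _ _ => tt)), (fun=> v).
Qed.

Lemma finrec_map (Sigma V W : Type) (g : V -> W) (S : nseries Sigma V) :
  finrec S -> finrec (fun n nu l => g (S n nu l)).
Proof.
by case=> D [f hS]; exists D, (fun q => g (f q)) => n nu l nest; rewrite hS.
Qed.

Definition rprod Sigma (D1 D2 : rdnwa Sigma) : rdnwa Sigma :=
  @RDNWA Sigma (rstate D1 * rstate D2)%type (rinit D1, rinit D2)
    (fun a => (rcall D1 a, rcall D2 a))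
    (fun q a => (rint q.1 a, rint q.2 a))
    (fun q q' a => (rret q.1 q'.1 a, rret q.2 q'.2 a)).

Lemma finrec_map2 (Sigma V1 V2 W : Type) (op : V1 -> V2 -> W)
    (S1 : nseries Sigma V1) (S2 : nseries Sigma V2) :
  finrec S1 -> finrec S2 -> finrec (fun n nu l => op (S1 n nu l) (S2 n nu l)).
Proof.
case=> D1 [f1 h1] [D2 [f2 h2]].
exists (rprod D1 D2), (fun q => op (f1 q.1) (f2 q.2)) => n nu l nest.
have c1 w : map fst (config (rprod D1 D2) w) = config D1 w.
  elim: w => //= [[[] a] w <-] //; rewrite /rstep /=; first by case: config.
  by case: config => [|? []].
have c2 w : map snd (config (rprod D1 D2) w) = config D2 w.
  elim: w => //= [[[] a] w <-] //; rewrite /rstep /=; first by case: config.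
  by case: config => [|? []].
rewrite h1 // h2 //.
have := c1 (tword nu l); rewrite !config_tword // => -[<-].
by have := c2 (tword nu l); rewrite !config_tword // => -[<-].
Qed.

Lemma finrec_relabel (Sigma Sigma' V : Type) (h : Sigma -> Sigma')
    (S : nseries Sigma' V) :
  finrec S -> finrec (fun n nu l => S n nu (fun p => h (l p))).
Proof.
case=> D [f hS].
exists (@RDNWA Sigma (rstate D) (rinit D) (fun a => rcall D (h a))
   (fun q a => rint q (h a)) (fun q q' a => rret q q' (h a))), f => n nu l nest.
rewrite hS // /rrun; congr (f (head _ _)).
rewrite /tword /config -!map_rev; elim: (rev _) => //= i s ->.
by rewrite /rstep /=; case: tagof.
Qed.

(* A word automaton is simulated by the automaton computing, for the part of
   the word read since the last pending call, the transformation of the states. *)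
Lemma finrec_word (Sigma : Type) (Q : finType) (q0 : Q) (delta : Q -> Sigma -> Q) :
  finrec (fun n (nu : {set 'I_n * 'I_n}) l => foldl delta q0 [seq l p | p <- enum 'I_n]).
Proof.
pose D := @RDNWA Sigma {ffun Q -> Q} [ffun q => q] (fun a => [ffun q => delta q a])
  (fun g a => [ffun q => delta (g q) a])
  (fun g1 g0 a => [ffun q => delta (g1 (g0 q)) a]).
exists D, (fun g : {ffun Q -> Q} => g q0) => n nu l nest.
(* Composing the transformations on the stack, the outermost level acting first, recovers the state
   of the word automaton. *)
have inv (w : seq (ptag * Sigma)) d q : well_matched w d ->
    foldr (fun (g : {ffun Q -> Q}) => g) q (config D w) = foldr (fun x q => delta q x.2) q w.
  elim: w d => [|[[] a] w IH] d /=; first by rewrite ffunE.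
  - by case: d => // d /IH <-; rewrite ffunE.
  - move=> wm; rewrite -(IH _ wm); have := size_config D wm.
    by rewrite -/(config D w); case: (config D w) => // g c _; rewrite /rstep /= ffunE.
  - move=> wm; rewrite -(IH _ wm); have := size_config D wm.
    by rewrite -/(config D w); case: (config D w) => // g [] // g' c _; rewrite /rstep /= ffunE.
have := inv _ _ q0 (well_matched_tword l nest); rewrite config_tword //= => ->.
rewrite -[map _ _]revK foldl_rev /tword -!map_rev.
by elim: (rev _) => //= i s ->.
Qed.

Lemma finrec_letters (Sigma : finType) :
  finrec (fun n (nu : {set 'I_n * 'I_n}) (l : 'I_n -> Sigma) => [set l p | p in 'I_n]).
Proof.
have [D [f hD]] := finrec_word (set0 : {set Sigma}) (fun A a => a |: A).
exists D, f => n nu l nest; rewrite -hD //.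
have key (s : seq Sigma) : foldl (fun (A : {set Sigma}) a => a |: A) set0 s =i s.
  elim/last_ind: s => [|s a IH] b; first by rewrite inE.
  by rewrite foldl_rcons !inE mem_rcons inE IH.
apply/setP => b; rewrite key; apply/imsetP/mapP => -[p _ ->]; exists p => //.
by rewrite mem_enum.
Qed.

Lemma finrec_exists (Sigma : finType) (P : pred Sigma) :
  finrec (fun n (nu : {set 'I_n * 'I_n}) l => [exists p, P (l p)]).
Proof.
have [D [f hD]] := finrec_map (fun A : {set Sigma} => [exists (a | a \in A), P a])
  (finrec_letters Sigma).
exists D, f => n nu l nest; rewrite -hD //.
apply/existsP/exists_inP => [[p Pp]|[a /imsetP[p _ ->] Pp]]; last by exists p.
by exists (l p) => //; apply: imset_f.
Qed.

(** The two bits of the state record at least one and at least two occurrences. The lemma recognises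
    singletons, through which quantification over positions becomes quantification over sets. *)
Lemma finrec_single (Sigma : finType) (P : pred Sigma) :
  finrec (fun n (nu : {set 'I_n * 'I_n}) l => #|[set p | P (l p)]| == 1).
Proof.
pose delta (s : bool * bool) a := (s.1 || P a, s.2 || (s.1 && P a)).
have [D [f hD]] := finrec_map (fun s => s.1 && ~~ s.2)
  (finrec_word (false, false) delta).
exists D, f => n nu l nest; rewrite -hD //.
have key (s : seq Sigma) : foldl delta (false, false) s = (0 < count P s, 1 < count P s).
  elim/last_ind: s => [|s a IH] //.
  rewrite foldl_rcons IH -cats1 count_cat /= /delta /=.
  by case: (P a) => /=; case: (count P s) => [|[|k]] //; rewrite ?addn1 ?addn0.
rewrite key count_map /=.
have -> : #|[set p | P (l p)]| = count (preim l P) (enum 'I_n).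
  by rewrite -sum1dep_card -sum1_count big_enum_cond.
by case: (count _ _) => [|[|]].
Qed.

Lemma take_enumS n (p : 'I_n) : take p.+1 (enum 'I_n) = rcons (take p (enum 'I_n)) p.
Proof. by rewrite (take_nth p) ?size_enum_ord // nth_ord_enum. Qed.

Lemma finrec_before (Sigma : finType) (P R : pred Sigma) :
  finrec (fun n (nu : {set 'I_n * 'I_n}) l =>
    [exists i : 'I_n, exists j : 'I_n, [&& i <= j, P (l i) & R (l j)]]).
Proof.
(* The current letter already counts as a candidate for [i], because [i = j] is allowed. *)
pose delta (s : bool * bool) a := (s.1 || P a, s.2 || ((s.1 || P a) && R a)).
have [D [f hD]] := finrec_map snd (finrec_word (false, false) delta).
exists D, f => n nu l nest; rewrite -hD //.
have key p : p <= n -> foldl delta (false, false) [seq l p | p <- take p (enum 'I_n)] =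
    ([exists i : 'I_n, (i < p) && P (l i)],
     [exists i : 'I_n, exists j : 'I_n, [&& j < p, i <= j, P (l i) & R (l j)]]).
  elim: p => [|p IH] ltpn.
    rewrite take0 /=; congr (_, _); apply/esym/negbTE/existsPn => i //.
    by apply/existsPn => j.
  set o := Ordinal ltpn; rewrite -[p]/(val o) take_enumS map_rcons foldl_rcons.
  rewrite IH ?(ltnW ltpn) // /delta /=.
  have eqs : [exists i : 'I_n, (i < p) && P (l i)] || P (l o) =
             [exists i : 'I_n, (i < p.+1) && P (l i)].
    apply/orP/existsP => [[/existsP[i /andP[lip Pi]]|Po]|[i /andP[lip Pi]]].
    - by exists i; rewrite Pi ltnW.
    - by exists o; rewrite Po leqnn.
    - move: lip; rewrite ltnS leq_eqVlt => /orP[/eqP ei|lip].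
        by right; have -> : o = i by apply: val_inj.
      by left; apply/existsP; exists i; rewrite lip.
  congr (_, _) => //; rewrite eqs.
  apply/orP/existsP => [[/existsP[i /existsP[j /and4P[ljp lij Pi Rj]]]|]|].
  - by exists i; apply/existsP; exists j; rewrite ltnW // lij Pi Rj.
  - case/andP=> /existsP[i /andP[lip Pi]] Ro; exists i; apply/existsP; exists o.
    by rewrite leqnn Pi Ro -ltnS lip.
  - case=> i /existsP[j /and4P[ljp lij Pi Rj]].
    move: ljp; rewrite ltnS leq_eqVlt => /orP[/eqP ej|ljp].
      right; have -> : o = j by apply: val_inj.
      by rewrite Rj andbT; apply/existsP; exists i; rewrite Pi -ej ltnS lij.
    by left; apply/existsP; exists i; apply/existsP; exists j; rewrite ljp lij Pi Rj.
have -> : enum 'I_n = take n (enum 'I_n) by rewrite take_oversize // size_enum_ord.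
rewrite key //=; apply/eq_existsb => i; apply/eq_existsb => j.
by rewrite ltn_ord.
Qed.

Lemma finrec_nu (Sigma : Type) (P R : pred Sigma) :
  finrec (fun n (nu : {set 'I_n * 'I_n}) l =>
    [exists i : 'I_n, exists j : 'I_n, [&& (i, j) \in nu, P (l i) & R (l j)]]).
Proof.
(* First component: [P] holds at the innermost pending call.  Second: a pair
   was found at the current level. *)
pose D := @RDNWA Sigma (bool * bool)%type (false, false) (fun a => (P a, false))
  (fun s _ => s) (fun s1 s0 a => (s0.1, [|| s0.2, s1.2 | s1.1 && R a])).
exists D, snd => n nu l nest.
(* The [false] at the bottom belongs to the outermost level, which no call opened. A pair once found
   stays flagged somewhere on the stack, since a return hands the flag of the finished level to the
   level below. *)
have key p : p <= n ->
    map fst (config D (tprefix nu l p)) = rcons [seq P (l i) | i <- open_calls nu p] false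
 /\ has snd (config D (tprefix nu l p)) =
     [exists i : 'I_n, exists j : 'I_n, [&& j < p, (i, j) \in nu, P (l i) & R (l j)]].
  elim: p => [|p IH] ltpn.
    rewrite tprefix0 open_calls0; split=> //; apply/esym/negbTE/existsPn => i.
    by apply/existsPn.
  have [] := IH (ltnW ltpn); set o := Ordinal ltpn; rewrite -[p]/(val o).
  have step : (forall i, (i, o) \notin nu) ->
     [exists i : 'I_n, exists j : 'I_n, [&& j < o.+1, (i, j) \in nu, P (l i) & R (l j)]] =
     [exists i : 'I_n, exists j : 'I_n, [&& j < o, (i, j) \in nu, P (l i) & R (l j)]].
    move=> nr; apply/eq_existsb => i; apply/eq_existsb => j.
    rewrite ltnS leq_eqVlt; case: eqP => // ej; have -> : j = o by apply: val_inj.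
    by rewrite (negbTE (nr i)) /= andbF.
  rewrite tprefixS /= -/(config D _) /tagof.
  case: ifPn => [/existsP[i io]|nr].
    rewrite (open_calls_ret nest io) /=.
    case: (config D _) => [|[o1 f1] [|[o0 f0] c]] //=.
      by case=> _; case: (map _ _).
    case=> -> -> eqh; split=> //.
    have -> : [|| f0, f1 | P (l i) && R (l o)] || has snd c =
              (P (l i) && R (l o)) || [|| f1, f0 | has snd c].
      by case: f0 {eqh}; case: f1; case: (_ && _); case: has.
    rewrite eqh; apply/orP/existsP.
    - case=> [PR|/existsP[i' /existsP[j /andP[lj h]]]].
        by exists i; apply/existsP; exists o; rewrite leqnn io.
      by exists i'; apply/existsP; exists j; rewrite ltnW.
    - case=> i' /existsP[j /andP[]]; rewrite ltnS leq_eqVlt => /orP[/eqP ej|lj h].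
        have -> : j = o by apply: val_inj.
        by case/andP=> /(nest_funl nest io) <- ?; left.
      by right; apply/existsP; exists i'; apply/existsP; exists j; rewrite lj.
  rewrite step; last by move/existsPn: nr.
  case: ifPn => [/existsP[j pj]|nc].
    by rewrite (open_calls_call nest pj) /= => -> ->.
  rewrite (open_calls_int nr nc); case: (config D _) => [|c cs] //=.
have [_] := key n (leqnn n); rewrite tprefixn config_tword //= orbF => ->.
by apply/eq_existsb => i; apply/eq_existsb => j; rewrite ltn_ord.
Qed.

(** * Counting marked positions *)

(* The quotient of the semiring of naturals with threshold [N] and period [N]. *)
Definition red (N n : nat) : nat := if n < N then n else N + n %% N.

Section Red.
Variable N : nat.
Hypothesis N_gt0 : 0 < N.

Lemma red_lt n : red N n < N.*2.
Proof.
rewrite /red -addnn; case: (ltnP n N) => h; first exact: leq_trans h (leq_addr _ _).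
by rewrite ltn_add2l ltn_mod.
Qed.

Lemma red_eqP m n :
  red N m = red N n <-> m = n \/ [/\ N <= m, N <= n & m = n %[mod N]].
Proof.
rewrite /red; split=> [|[->//|[lm ln e]]]; last by rewrite !ltnNge lm ln e.
case: (ltnP m N) => hm; case: (ltnP n N) => hn; [by left| | |].
- by move=> e; move: hm; rewrite e ltnNge leq_addr.
- by move=> e; move: hn; rewrite -e ltnNge leq_addr.
- by move/addnI=> e; right.
Qed.

Lemma red_red n : red N (red N n) = red N n.
Proof.
apply/red_eqP; rewrite /red; case: (ltnP n N) => h; [by left | right].
by rewrite leq_addr modnDl modn_mod.
Qed.

Lemma red_add m m' n n' :
  red N m = red N m' -> red N n = red N n' -> red N (m + n) = red N (m' + n').
Proof.
move/red_eqP=> hm /red_eqP hn; apply/red_eqP.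
case: hm hn => [->|[h1 h2 e]] [->|[h3 h4 e']]; first by left.
- by right; rewrite !(leq_trans _ (leq_addl _ _)) // -modnDmr e' modnDmr.
- by right; rewrite !(leq_trans _ (leq_addr _ _)) // -modnDml e modnDml.
- by right; rewrite !(leq_trans _ (leq_addr _ _)) // -modnDml e modnDml -modnDmr e' modnDmr.
Qed.

Lemma red_mul m m' n n' :
  red N m = red N m' -> red N n = red N n' -> red N (m * n) = red N (m' * n').
Proof.
suff key a b c : red N a = red N b -> red N (a * c) = red N (b * c).
  move=> hm hn; rewrite (key _ _ n hm) ![m' * _]mulnC; exact: key.
move/red_eqP=> h; apply/red_eqP.
case: h => [->|[h1 h2 e]]; first by left.
case: c => [|c]; first by left; rewrite !muln0.
right; rewrite -modnMml e modnMml; split=> //.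
  exact: leq_trans h1 (leq_pmulr _ _).
exact: leq_trans h2 (leq_pmulr _ _).
Qed.

Lemma red_sum (I : Type) (r : seq I) (F G : I -> nat) :
  (forall i, red N (F i) = red N (G i)) ->
  red N (\sum_(i <- r) F i) = red N (\sum_(i <- r) G i).
Proof.
move=> h; elim: r => [|i r IH]; first by rewrite !big_nil.
by rewrite !big_cons; apply: red_add.
Qed.

(** Beyond the threshold an exponent may drop by multiples of [N] as long as one copy of [N] is
    kept, which is where the summand [N] in [red] comes from. *)
Lemma iter_red (V : Type) (g : V -> V) (v : V) :
  (forall n, N <= n -> iter (n + N) g v = iter n g v) ->
  forall n, iter (red N n) g v = iter n g v.
Proof.
move=> per n; rewrite /red; case: (ltnP n N) => // leNn.
have key k m : N <= m -> iter (k * N + m) g v = iter m g v.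
  move=> lm; elim: k => [|k IH] //; rewrite mulSn -addnA addnC per //.
  exact: leq_trans lm (leq_addl _ _).
rewrite {2}(divn_eq n N); have : 0 < n %/ N by rewrite divn_gt0.
by case: (n %/ N) => // k _; rewrite mulSn (addnC N (k * N)) -addnA key ?leq_addr.
Qed.
End Red.

Section Count.
Variables (Sigma : eqType) (D : rdnwa (Sigma * bool)) (M : nat).
Local Notation N := M.+1.
Local Notation Q := (rstate D).
(** Values of [red N] lie below [N.*2], which is [M.*2.+2]; writing [N] as [M.+1] makes this type
    visibly nonempty, as [inord] requires. *)
Local Notation R := 'I_(M.*2.+2).

Let rd (n : nat) : R := inord (red N n).

Let val_rd n : rd n = red N n :> nat.
Proof. by rewrite /rd inordK // -doubleS red_lt. Qed.

(** A state [C] stores for each [q] the number, up to [red N], of markings of the letters from the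
    last pending call on that bring [D] to [q]. At a return the inner and the outer level have been
    marked independently, so their counts multiply. *)
Definition rcount : rdnwa Sigma :=
  @RDNWA Sigma {ffun Q -> R}
    [ffun q => rd (q == rinit D)]
    (fun a => [ffun q => rd (\sum_(b : bool) (rcall D (a, b) == q))])
    (fun C a => [ffun q => rd (\sum_(b : bool) \sum_(q1 : Q) C q1 * (rint q1 (a, b) == q))])
    (fun C1 C0 a => [ffun q => rd (\sum_(b : bool) \sum_(q1 : Q) \sum_(q0 : Q)
        C1 q1 * C0 q0 * (rret q1 q0 (a, b) == q))]).

Fixpoint extensions (w : seq (ptag * Sigma)) : seq (seq (ptag * (Sigma * bool))) :=
  if w is x :: w' then
    [seq (x.1, (x.2, b)) :: v | b <- [:: true; false], v <- extensions w']
  else [:: [::]].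

Let cnt w (s : seq Q) := \sum_(v <- extensions w) (config D v == s).

Let cnt_cons x w s : cnt (x :: w) s =
  \sum_(b : bool) \sum_(v <- extensions w) (rstep (x.1, (x.2, b)) (config D v) == s).
Proof. by rewrite /cnt /= cats0 big_cat !big_map big_bool. Qed.

Let sum_eq (q0 : Q) (F : Q -> nat) : \sum_q (q0 == q) * F q = F q0.
Proof.
rewrite (bigD1 q0) //= eqxx mul1n big1 ?addn0 // => q /negbTE ne.
by rewrite eq_sym ne.
Qed.

Lemma size_config_extension w d v : well_matched w d -> v \in extensions w -> size (config D v) = d.+1.
Proof.
move=> wm hv; apply: size_config.
elim: w d v wm hv => [|[t a] w IH] d v /=; first by move=> /eqP->; rewrite inE => /eqP->.
rewrite cats0 mem_cat => wm /orP[]/mapP[v' hv' ->] /=;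
by case: t wm => wm; [case: d wm => // d wm| |]; apply: IH wm hv'.
Qed.

(* The levels of the stack are independent, so the number of extensions
   reaching a given configuration is a product over the levels. *)
Lemma count_config w d s : well_matched w d -> size s = d.+1 ->
  red N (cnt w s) = red N (\prod_(x <- zip (config rcount w) s) (x.1 : {ffun Q -> R}) x.2).
Proof.
elim: w d s => [|[t a] w IH] d s.
  move=> /= /eqP-> ; case: s => [|q []] // _.
  rewrite /cnt /= !big_seq1 /= ffunE val_rd red_red // /config /=.
  by rewrite eqseq_cons andbT eq_sym.
move=> wm; case: s => [|q s] // [] sz; rewrite cnt_cons; case: t wm => /= wm.
- case: d wm sz => // d wm sz.
  rewrite big_cons /= ffunE val_rd.
  (* Restarting pays off here: the new top depends on the bit of the call letter alone, the rest of
     the stack on the earlier word alone. *)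
  transitivity (red N ((\sum_(b : bool) (rcall D (a, b) == q)) * cnt w s)).
    congr red; rewrite big_distrl /=; apply: eq_bigr => b _.
    rewrite /cnt big_distrr /=; apply: eq_bigr => v _.
    by rewrite eqseq_cons mulnb.
  by apply: red_mul => //; [rewrite red_red | apply: IH sz].
- have := size_config rcount wm; rewrite -/(config rcount w).
  case E: (config rcount w) => [|C c] // [szc]; rewrite /rstep /= big_cons /= ffunE val_rd.
  transitivity (red N (\sum_(b : bool) \sum_(q1 : Q) cnt w (q1 :: s) * (rint q1 (a, b) == q))).
    congr red; apply: eq_bigr => b _.
    rewrite /cnt; under [RHS]eq_bigr do rewrite big_distrl /=.
    rewrite exchange_big /=; apply: eq_big_seq => v hv.
    have := size_config_extension wm hv; case: (config D v) => [|q1 c1] // _.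
    (* A Kronecker sum over the old top state turns the condition on the new stack into conditions
       on old stacks, to which the induction hypothesis applies. *)
    transitivity (\sum_q2 (q1 == q2) * ((c1 == s) * (rint q2 (a, b) == q))).
      by rewrite sum_eq eqseq_cons mulnC mulnb.
    by apply: eq_bigr => q2 _; rewrite eqseq_cons -mulnb mulnA.
  transitivity (red N ((\sum_(b : bool) \sum_(q1 : Q) C q1 * (rint q1 (a, b) == q)) *
     \prod_(x <- zip c s) (x.1 : {ffun Q -> R}) x.2)).
    rewrite big_distrl /=; apply: red_sum => // b; rewrite big_distrl /=; apply: red_sum => // q1.
    rewrite /= mulnAC; apply: red_mul => //.
    by rewrite (IH _ (q1 :: s) wm) ?E /= ?sz // big_cons.
  by apply: red_mul => //; rewrite red_red.
- have := size_config rcount wm; rewrite -/(config rcount w).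
  case E: (config rcount w) => [|C1 [|C0 c]] // [szc].
  rewrite /rstep /= big_cons /= ffunE val_rd.
  (* A return merges the two top levels, so the old stacks are sorted by their top two states. *)
  transitivity (red N (\sum_(b : bool) \sum_(q1 : Q) \sum_(q0 : Q)
       cnt w [:: q1, q0 & s] * (rret q1 q0 (a, b) == q))).
    congr red; apply: eq_bigr => b _.
    rewrite /cnt; under [RHS]eq_bigr do under eq_bigr do rewrite big_distrl /=.
    under [RHS]eq_bigr do rewrite exchange_big /=.
    rewrite exchange_big /=; apply: eq_big_seq => v hv.
    have := size_config_extension wm hv; case: (config D v) => [|q1 [|q0 c1]] // _.
    transitivity (\sum_q2 (q1 == q2) * \sum_q3 (q0 == q3) *
        ((c1 == s) * (rret q2 q3 (a, b) == q))).
      by rewrite !sum_eq eqseq_cons mulnC mulnb.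
    apply: eq_bigr => q2 _; rewrite big_distrr /=; apply: eq_bigr => q3 _.
    by rewrite !eqseq_cons -!mulnb !mulnA.
  transitivity (red N ((\sum_(b : bool) \sum_(q1 : Q) \sum_(q0 : Q)
      C1 q1 * C0 q0 * (rret q1 q0 (a, b) == q)) *
     \prod_(x <- zip c s) (x.1 : {ffun Q -> R}) x.2)).
    rewrite big_distrl /=; apply: red_sum => // b; rewrite big_distrl /=; apply: red_sum => // q1.
    rewrite big_distrl /=; apply: red_sum => // q0.
    rewrite /= mulnAC; apply: red_mul => //.
    by rewrite (IH _ [:: q1, q0 & s] wm) ?E /= ?sz // !big_cons mulnA.
  by apply: red_mul => //; rewrite red_red.
Qed.

Lemma count_rrun n (nu : {set 'I_n * 'I_n}) (l : 'I_n -> Sigma) q : nesting_rel nu ->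
  red N (count (fun v => config D v == [:: q]) (extensions (tword nu l))) =
  red N ((rrun rcount nu l : {ffun Q -> R}) q).
Proof.
move=> nest; have := @count_config _ _ [:: q] (well_matched_tword l nest) erefl.
rewrite config_tword //= big_seq1 /= => <-; congr red.
by rewrite -sum1_count big_mkcond; apply: eq_bigr => v _; case: eqP.
Qed.
End Count.

(** Passes from markings as sets of positions to markings as words, on which the count is done by
    induction. *)
Lemma extensions_tword (Sigma : eqType) n (nu : {set 'I_n * 'I_n}) (l : 'I_n -> Sigma)
    (V : Type) (idx : V) (op : Monoid.com_law idx) (F : seq (ptag * (Sigma * bool)) -> V) :
  \big[op/idx]_(A : {set 'I_n}) F (tword nu (fun p => (l p, p \in A))) =
  \big[op/idx]_(v <- extensions (tword nu l)) F v.
Proof.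
rewrite (eq_bigr (fun A : {set 'I_n} =>
    F [seq (tagof nu i, (l i, i \in A)) | i <- rev (enum 'I_n)])); last first.
  by move=> A _; rewrite map_rev.
rewrite /tword -map_rev.
have : uniq (rev (enum 'I_n)) by rewrite rev_uniq enum_uniq.
have : forall i, i \in rev (enum 'I_n) by move=> i; rewrite mem_rev mem_enum.
move: (rev _) => s s_all s_uniq.
(* To induct on a list of positions, the sets are confined to that list; each step then splits them
   by membership of its head. *)
transitivity (\big[op/idx]_(A : {set 'I_n} | A \subset [set i in s])
    F [seq (tagof nu i, (l i, i \in (A : {set 'I_n}))) | i <- s]).
  apply: eq_bigl => A; apply/esym/subsetP => i _; by rewrite inE s_all.
elim: s s_uniq {s_all} F => [|i s IH] /= s_uniq F.
  by rewrite big_seq1 (big_pred1 set0) // => A; rewrite set_nil subset0.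
case/andP: s_uniq => nis s_uniq.
have niS : i \notin [set j in s] by rewrite inE.
rewrite cats0 big_cat !big_map -!IH // (bigID (fun A : {set 'I_n} => i \in A)) /=.
congr (op _ _).
  rewrite (reindex_onto (fun A => i |: A) (fun A : {set 'I_n} => A :\ i)) /=; last first.
    by move=> A /andP[_ iA]; rewrite setD1K.
  apply: eq_big => A.
    rewrite setU11 andbT set_cons; apply/andP/idP => [[sA /eqP <-]|sA].
      by rewrite subDset.
    by rewrite setUS // setU1K // (contra _ niS) // => /(subsetP sA).
  case/andP=> _ /eqP eA; rewrite setU11; congr (F (_ :: _)).
  apply/eq_in_map => j js; rewrite !inE; case: eqP => // ej.
  by rewrite -ej js in nis.
apply: eq_big => A.
  rewrite set_cons; apply/andP/idP => [[sA iA]|sA].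
    apply/subsetP => j jA; have := subsetP sA j jA; rewrite !inE.
    by case/orP=> // /eqP ej; rewrite -ej jA in iA.
  by rewrite (subset_trans sA (subsetUr _ _)) (contra _ niS) // => /(subsetP sA).
by case/andP=> _ /negbTE ->.
Qed.

(** Grouping the markings by the state [q] they lead to leaves iterates of [op (f q)]. Their
    exponents, the class sizes, matter only up to [red N], and [rcount] computes them so. *)
Lemma finrec_big (Sigma : eqType) (V : Type) (idx : V) (op : Monoid.com_law idx)
    (S : nseries (Sigma * bool) V) :
  (forall (Q : finType) (f : Q -> V), exists2 N, 0 < N & forall q n, N <= n ->
     iter (n + N) (op (f q)) idx = iter n (op (f q)) idx) ->
  finrec S ->
  finrec (fun n nu l => \big[op/idx]_(A : {set 'I_n}) S n nu (fun p => (l p, p \in A))).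
Proof.
move=> per [D [f hS]]; have [[//|M] _ {}per] := per _ f.
exists (rcount D M), (fun C : {ffun rstate D -> 'I_(M.*2.+2)} =>
  \big[op/idx]_q iter (C q) (op (f q)) idx) => n nu l nest.
rewrite (eq_bigr (fun A : {set 'I_n} =>
    f (head (rinit D) (config D (tword nu (fun p => (l p, p \in A))))))); last first.
  by move=> A _; rewrite hS.
rewrite (extensions_tword nu l op (fun v => f (head (rinit D) (config D v)))).
rewrite (partition_big (fun v => head (rinit D) (config D v)) xpredT) //=.
apply: eq_bigr => q _.
rewrite (eq_bigr (fun=> f q)); last by move=> v /eqP->.
rewrite big_const_seq -[LHS](iter_red (N := M.+1)) //; last exact: per.
rewrite -[RHS](iter_red (N := M.+1)) //; last exact: per.
congr iter; rewrite -count_rrun //; congr red.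
apply: eq_in_count => v hv /=.
have := size_config_extension D (well_matched_tword l nest) hv.
by case: (config D v) => [|q' []] //= _; rewrite eqseq_cons andbT.
Qed.

(** * Weighted automata *)

(** One [N] has to serve all the values [f q], because a single counting automaton reduces all its
    counts by the same [N]. *)
Definition eventually_periodic V (op : V -> V -> V) (idx : V) : Prop :=
  forall (Q : finType) (f : Q -> V), exists2 N, 0 < N & forall q n, N <= n ->
    iter (n + N) (op (f q)) idx = iter n (op (f q)) idx.

Lemma andb_eventually_periodic : eventually_periodic andb true.
Proof.
have h b k : iter k.+1 (andb b) true = b by elim: k => [|k /= ->]; case: b.
by move=> Q f; exists 1 => // q [//|n] _; rewrite addn1 !h.
Qed.

Lemma orb_eventually_periodic : eventually_periodic orb false.
Proof.
have h b k : iter k.+1 (orb b) false = b by elim: k => [|k /= ->]; case: b.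
by move=> Q f; exists 1 => // q [//|n] _; rewrite addn1 !h.
Qed.

(** Sets that are not singletons are given the neutral value [idx], so this is an instance of the
    aggregate over sets. *)
Lemma finrec_big1 (Sigma : finType) (V : Type) (idx : V) (op : Monoid.com_law idx)
    (S : nseries (Sigma * bool) V) :
  eventually_periodic op idx -> finrec S ->
  finrec (fun n nu l => \big[op/idx]_(i < n) S n nu (fun p => (l p, p \in [set i]))).
Proof.
move=> per fS.
have [D [f hD]] := finrec_big per (finrec_map2 (fun (b : bool) v => if b then v else idx)
  (@finrec_single _ (fun a : Sigma * bool => a.2)) fS).
exists D, f => n nu l nest; rewrite -hD //=.
rewrite -big_mkcond (eq_bigl (mem [set [set i] | i in 'I_n])) /=; last first.
  move=> A; rewrite (_ : [set _ | _] = A); last by apply/setP => p; rewrite inE.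
  apply/cards1P/imsetP => [[i ->]|[i _ ->]]; first by exists i.
  by exists i.
by rewrite big_imset //= => i j _ _ /set1_inj.
Qed.

Section Weighted.
Variable K : comPzSemiRingType.
Local Open Scope ring_scope.

(** The automata of the theorem, bundled over an arbitrary alphabet and read on labelled domains, so
    that closure under changes of alphabet can be stated. *)
Record wnwa (Sigma : Type) := WNWA {
  wstate : finType;
  winit : wstate -> K;
  wfinal : wstate -> K;
  wcall : wstate -> Sigma -> wstate -> K;
  wint : wstate -> Sigma -> wstate -> K;
  wret : wstate -> wstate -> Sigma -> wstate -> K }.

Definition pweight Sigma (A : wnwa Sigma) n (nu : {set 'I_n * 'I_n})
    (r : {ffun 'I_n.+1 -> wstate A}) (p : 'I_n) (a : Sigma) : K :=
  let bef := fun i : 'I_n => r (widen_ord (leqnSn _) i) in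
  let aft := r (lift ord0 p) in
  match [pick i | (i, p) \in nu] with
  | Some i => wret (bef p) (bef i) a aft
  | None => if [exists j, (p, j) \in nu] then wcall (bef p) a aft
            else wint (bef p) a aft
  end.

Definition wbehavior Sigma (A : wnwa Sigma) n (nu : {set 'I_n * 'I_n})
    (l : 'I_n -> Sigma) : K :=
  \sum_(r : {ffun 'I_n.+1 -> wstate A})
     (winit (r ord0) * (\prod_(p < n) pweight nu r p (l p)) * wfinal (r ord_max)).

Definition wregular Sigma (S : nseries Sigma K) : Prop :=
  exists A : wnwa Sigma, forall n (nu : {set 'I_n * 'I_n}) l,
    nesting_rel nu -> wbehavior A nu l = S n nu l.

Lemma wregular_ext Sigma (S T : nseries Sigma K) :
  (forall n (nu : {set 'I_n * 'I_n}) l, nesting_rel nu -> S n nu l = T n nu l) ->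
  wregular S -> wregular T.
Proof. by move=> e [A hA]; exists A => n nu l nest; rewrite hA // e. Qed.

Lemma prod_indicator (I : finType) (P : pred I) :
  \prod_i (if P i then 1 else 0 : K) = if [forall i, P i] then 1 else 0.
Proof.
case: ifPn => [/forallP h|/forallPn[i /negbTE ni]]; first by apply: big1 => i _; rewrite h.
by rewrite (bigD1 i) //= ni mul0r.
Qed.

(** With transition weights 0 and 1 only the run of [D] survives in the sum, and [f] serves as final
    weight. *)
Lemma finrec_wregular Sigma (S : nseries Sigma K) : finrec S -> wregular S.
Proof.
case=> D [f hS].
exists (@WNWA Sigma (rstate D) (fun q => if q == rinit D then 1 else 0) f
  (fun _ a q' => if q' == rcall D a then 1 else 0)
  (fun q a q' => if q' == rint q a then 1 else 0)
  (fun q1 q0 a q' => if q' == rret q1 q0 a then 1 else 0)) => n nu l nest.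
rewrite hS // /wbehavior /=.
pose next (r : {ffun 'I_n.+1 -> rstate D}) (p : 'I_n) :=
  match [pick i | (i, p) \in nu] with
  | Some i => rret (r (widen_ord (leqnSn n) p)) (r (widen_ord (leqnSn n) i)) (l p)
  | None => if [exists j, (p, j) \in nu] then rcall D (l p)
            else rint (r (widen_ord (leqnSn n) p)) (l p)
  end.
pose r0 : {ffun 'I_n.+1 -> rstate D} := [ffun i : 'I_n.+1 => rstate_at D nu l i].
have next0 (r : {ffun 'I_n.+1 -> rstate D}) (p : 'I_n) :
    (forall i : 'I_n.+1, (i <= p)%N -> r i = r0 i) -> next r p = r0 (lift ord0 p).
  move=> e; rewrite /next [RHS]ffunE /=; case: pickP => [i ip|nr].
    rewrite !e //=; last exact: ltnW (nest_lt nest ip).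
    by rewrite !ffunE -rstate_at_ret.
  have nr' : ~~ [exists i, (i, p) \in nu] by apply/existsPn => i; rewrite nr.
  case: ifPn => [/existsP[j pj]|nc]; first by rewrite (rstate_at_call _ _ nest pj).
  by rewrite e //= ffunE -rstate_at_int.
(* A state sequence that obeys the initial condition and every transition is the run [r0]; all
   others have a factor 0. *)
have uniq_run (r : {ffun 'I_n.+1 -> rstate D}) :
    ((r ord0 == rinit D) && [forall p, r (lift ord0 p) == next r p]) = (r == r0).
  apply/andP/eqP => [[/eqP h0 /forallP hS']|->]; last first.
    split; first by rewrite ffunE rstate_at0.
    by apply/forallP => p; rewrite next0.
  have key k (i : 'I_n.+1) : (i <= k)%N -> r i = r0 i.
    elim: k i => [|k IH] i.
      rewrite leqn0 => /eqP i0; have -> : i = ord0 by apply: val_inj.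
      by rewrite h0 ffunE rstate_at0.
    rewrite leq_eqVlt => /orP[/eqP ik|]; last by rewrite ltnS => /IH.
    have kn : (k < n)%N by have := ltn_ord i; rewrite ik.
    have -> : i = lift ord0 (Ordinal kn) by apply: val_inj; rewrite /= ik.
    by rewrite (eqP (hS' _)) next0 //= => j /IH.
  by apply/ffunP => i; apply: (key i).
rewrite (bigD1 r0) //= [X in _ + X]big1 => [|r ne]; last first.
  rewrite (eq_bigr (fun p => if r (lift ord0 p) == next r p then 1 else 0)); last first.
    move=> p _; rewrite /pweight /next /=; case: pickP => // _.
    by case: ifP.
  rewrite prod_indicator; move: ne; rewrite -uniq_run.
  by case: (r ord0 == _) => /=; [move/negbTE-> | rewrite !mul0r]; rewrite ?mulr0 ?mul0r.
rewrite (eq_bigr (fun p => if r0 (lift ord0 p) == next r0 p then 1 else 0)); last first.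
  by move=> p _; rewrite /pweight /next /=; case: pickP => // _; case: ifP.
have := uniq_run r0; rewrite eqxx prod_indicator => /andP[-> ->].
by rewrite !mul1r addr0 ffunE /= rstate_atn.
Qed.

(** Commutativity of [K] separates the interleaved weights of a run of the product automaton into
    those of two runs. *)
Lemma wregular_mul Sigma (S T : nseries Sigma K) : wregular S -> wregular T ->
  wregular (fun n nu l => S n nu l * T n nu l).
Proof.
case=> A hA [B hB].
exists (@WNWA Sigma (wstate A * wstate B)%type
  (fun q => winit q.1 * winit q.2) (fun q => wfinal q.1 * wfinal q.2)
  (fun q a q' => wcall q.1 a q'.1 * wcall q.2 a q'.2)
  (fun q a q' => wint q.1 a q'.1 * wint q.2 a q'.2)
  (fun q1 q0 a q' => wret q1.1 q0.1 a q'.1 * wret q1.2 q0.2 a q'.2)) => n nu l nest.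
rewrite -hA // -hB // /wbehavior /= big_distrlr pair_big /=.
rewrite (reindex (fun r : {ffun 'I_n.+1 -> wstate A} * {ffun 'I_n.+1 -> wstate B} =>
  [ffun i => (r.1 i, r.2 i)])) /=; last first.
  exists (fun r : {ffun 'I_n.+1 -> wstate A * wstate B} =>
     ([ffun i => (r i).1], [ffun i => (r i).2])) => [[r1 r2] _|r _].
    by congr (_, _); apply/ffunP => i; rewrite !ffunE.
  by apply/ffunP => i; rewrite !ffunE /=; case: (r i).
apply: eq_bigr => -[r1 r2] _ /=; rewrite !ffunE /=.
rewrite (eq_bigr (fun p => pweight nu r1 p (l p) * pweight nu r2 p (l p))); last first.
  move=> p _; rewrite /pweight /=; case: pickP => [i _|_]; first by rewrite !ffunE.
  by case: ifP; rewrite !ffunE.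
by rewrite big_split /= [X in X * _]mulrACA mulrACA.
Qed.

Lemma wregular_add Sigma (S T : nseries Sigma K) : wregular S -> wregular T ->
  wregular (fun n nu l => S n nu l + T n nu l).
Proof.
case=> A hA [B hB].
pose mk (f : wstate A -> Sigma -> wstate A -> K) (g : wstate B -> Sigma -> wstate B -> K)
   (q : wstate A + wstate B) a (q' : wstate A + wstate B) : K :=
  match q, q' with inl q, inl q' => f q a q' | inr q, inr q' => g q a q' | _, _ => 0 end.
pose C := @WNWA Sigma (wstate A + wstate B)%type
  (fun q => match q with inl q => winit q | inr q => winit q end)
  (fun q => match q with inl q => wfinal q | inr q => wfinal q end)
  (mk (@wcall _ A) (@wcall _ B)) (mk (@wint _ A) (@wint _ B))
  (fun q1 q0 a q' => match q1, q0, q' with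
     inl q1, inl q0, inl q' => wret q1 q0 a q'
   | inr q1, inr q0, inr q' => wret q1 q0 a q' | _, _, _ => 0 end).
exists C => n nu l nest; rewrite -hA // -hB // /wbehavior.
pose L (r : {ffun 'I_n.+1 -> wstate A}) : {ffun 'I_n.+1 -> wstate C} := [ffun i => inl (r i)].
pose R (r : {ffun 'I_n.+1 -> wstate B}) : {ffun 'I_n.+1 -> wstate C} := [ffun i => inr (r i)].
have injL : injective L.
  by move=> r r' /ffunP e; apply/ffunP => i; have := e i; rewrite !ffunE => -[].
have injR : injective R.
  by move=> r r' /ffunP e; apply/ffunP => i; have := e i; rewrite !ffunE => -[].
rewrite (bigID (mem [set L r | r in {: {ffun 'I_n.+1 -> wstate A}}])) /=; congr (_ + _).
  rewrite big_imset /=; last by move=> ? ? _ _ /injL.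
  apply: eq_bigr => r _; rewrite !ffunE /=; congr (_ * _ * _).
  apply: eq_bigr => p _; rewrite /pweight /=; case: pickP => [i _|_]; first by rewrite !ffunE.
  by case: ifP; rewrite !ffunE.
rewrite (bigID (mem [set R r | r in {: {ffun 'I_n.+1 -> wstate B}}])) /=.
rewrite [X in _ + X]big1 ?addr0 => [|r /andP[nL nR]].
  rewrite (eq_bigl (fun r => r \in [set R r | r in {: {ffun 'I_n.+1 -> wstate B}}])) /=;
    last first.
    move=> r; case rR: (r \in R @: _); last by rewrite andbF.
    rewrite andbT; apply/imsetP => -[r1 _ e]; case/imsetP: rR => r2 _.
    by rewrite e => /ffunP/(_ ord0); rewrite !ffunE.
  rewrite big_imset /=; last by move=> ? ? _ _ /injR.
  apply: eq_bigr => r _; rewrite !ffunE /=; congr (_ * _ * _).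
  apply: eq_bigr => p _; rewrite /pweight /=; case: pickP => [i _|_]; first by rewrite !ffunE.
  by case: ifP; rewrite !ffunE.
(* A sequence contained in neither summand changes sides at some position, and the weight there is
   0. *)
pose side (i : 'I_n.+1) := if r i is inl _ then true else false.
have [/forallP same|/forallPn[p np]] :=
    boolP [forall p : 'I_n, side (widen_ord (leqnSn n) p) == side (lift ord0 p)].
  have key k (i : 'I_n.+1) : (i <= k)%N -> side i = side ord0.
    elim: k i => [|k IH] i.
      by rewrite leqn0 => /eqP i0; congr side; apply: val_inj.
    rewrite leq_eqVlt => /orP[/eqP ik|]; last by rewrite ltnS => /IH.
    have kn : (k < n)%N by have := ltn_ord i; rewrite ik.
    have -> : i = lift ord0 (Ordinal kn) by apply: val_inj; rewrite /= ik.
    by rewrite -(eqP (same _)) IH.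
  have {}key i : side i = side ord0 by apply: (key i).
  case E: (r ord0) key => [q0|q0]; rewrite {2}/side E => key.
    case/negP: nL; apply/imsetP; exists [ffun i => if r i is inl q then q else q0] => //.
    by apply/ffunP => i; rewrite !ffunE; have := key i; rewrite /side; case: (r i).
  case/negP: nR; apply/imsetP; exists [ffun i => if r i is inr q then q else q0] => //.
  by apply/ffunP => i; rewrite !ffunE; have := key i; rewrite /side; case: (r i).
suff -> : \prod_(p < n) pweight (A := C) nu r p (l p) = 0 by rewrite mulr0 mul0r.
rewrite (bigD1 p) //=; apply/eqP; rewrite (_ : pweight (A := C) nu r p (l p) = 0) ?mul0r //.
move: np; rewrite /pweight /side /= /mk.
case: (r (widen_ord _ p)) => q; case: (r (lift _ _)) => q' // _; case: pickP => [i _|_];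
  try by case: (r (widen_ord _ i)).
all: by case: ifP.
Qed.

Lemma wregular_prod Sigma (h : Sigma -> K) :
  wregular (fun n (nu : {set 'I_n * 'I_n}) l => \prod_(p < n) h (l p)).
Proof.
exists (@WNWA Sigma unit (fun=> 1) (fun=> 1) (fun _ a _ => h a) (fun _ a _ => h a)
  (fun _ _ a _ => h a)) => n nu l nest.
rewrite /wbehavior (big_pred1 [ffun=> tt]) /= => [|r]; last first.
  by apply/esym/eqP/ffunP => i; rewrite !ffunE; case: (r i).
rewrite mul1r mulr1; apply: eq_bigr => p _; rewrite /pweight /=.
by case: pickP => // _; case: ifP.
Qed.

(** For a fixed run the forgotten components are chosen independently at each position, so by
    distributivity they can be summed inside each transition weight. *)
Lemma wregular_proj Sigma (B : finType) (S : nseries (Sigma * B) K) : wregular S ->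
  wregular (fun n nu l => \sum_(b : {ffun 'I_n -> B}) S n nu (fun p => (l p, b p))).
Proof.
case=> A hA.
exists (@WNWA Sigma (wstate A) (@winit _ A) (@wfinal _ A)
  (fun q a q' => \sum_b wcall q (a, b) q') (fun q a q' => \sum_b wint q (a, b) q')
  (fun q1 q0 a q' => \sum_b wret q1 q0 (a, b) q')) => n nu l nest.
under [RHS]eq_bigr do rewrite -hA //.
rewrite /wbehavior exchange_big /=; apply: eq_bigr => r _.
rewrite -big_distrl -big_distrr /=; congr (_ * _ * _).
rewrite -(bigA_distr_bigA (fun p b => pweight nu r p (l p, b))) /=.
apply: eq_bigr => p _; rewrite /pweight /=.
by case: pickP => // _; case: ifP.
Qed.

Lemma wregular_sum_sets Sigma (S : nseries (Sigma * bool) K) : wregular S ->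
  wregular (fun n nu l => \sum_(A : {set 'I_n}) S n nu (fun p => (l p, p \in A))).
Proof.
move=> [A hA]; have [|C hC] := @wregular_proj Sigma bool (fun n nu l => wbehavior A nu l).
  by exists A.
exists C => n nu l nest; rewrite hC //.
rewrite (reindex (fun X : {set 'I_n} => [ffun p => p \in X])) /=; last first.
  exists (fun b : {ffun 'I_n -> bool} => [set p | b p]) => [X _|b _].
    by apply/setP => p; rewrite inE ffunE.
  by apply/ffunP => p; rewrite ffunE inE.
apply: eq_bigr => X _; rewrite -hA //; apply: eq_bigr => r _; congr (_ * _ * _).
by apply: eq_bigr => p _; rewrite ffunE.
Qed.

(* The states reached by the deterministic automaton when [x] marks each
   position in turn are guessed as a second labelling and then checked. *)
Lemma wregular_forall (Sigma : finType) (S : nseries (Sigma * bool) K) : finrec S ->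
  wregular (fun n nu l => \prod_(i < n) S n nu (fun p => (l p, p \in [set i]))).
Proof.
case=> D [f hS].
pose check := fun n (nu : {set 'I_n * 'I_n}) (l : 'I_n -> Sigma * rstate D) =>
  [forall i, rrun D nu (fun p => ((l p).1, p \in [set i])) == (l i).2].
have fcheck : finrec check.
  (* [U] tests one mark: [D] reads the marked word, and the state it reaches is compared with the
     guess stored at the marked position. The full check is the conjunction of [U] over all
     positions of the mark. *)
  pose U := fun n (nu : {set 'I_n * 'I_n}) (m : 'I_n -> (Sigma * rstate D) * bool) =>
    [exists (a | a \in [set m p | p in 'I_n]),
      a.2 && (rrun D nu (fun p => ((m p).1.1, (m p).2)) == a.1.2)].
  have fU : finrec U.
    apply: (finrec_map2 (fun (X : {set _}) q => [exists (a | a \in X), a.2 && (q == a.1.2)])).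
      exact: finrec_letters.
    apply: (finrec_relabel (fun a : (Sigma * rstate D) * bool => (a.1.1, a.2))
       (S := fun n nu l => rrun D nu l)).
    by exists D, id.
  have [E [g hE]] := finrec_big1 (op := andb) andb_eventually_periodic fU.
  exists E, g => n nu l nest; rewrite -hE // big_andE; apply/eq_forallb => i.
  rewrite /U; apply/eqP/exists_inP => /=.
    move=> e; exists (l i, true); first by apply/imsetP; exists i => //; rewrite set11.
    by rewrite /= e.
  case=> a /imsetP[p _ ->] /=; rewrite inE => /andP[/eqP -> /eqP].
  by [].
have := wregular_proj (wregular_mul
  (finrec_wregular (finrec_map (fun b : bool => if b then 1 else 0 : K) fcheck))
  (wregular_prod (fun a : Sigma * rstate D => f a.2))).
apply: wregular_ext => n nu l nest.
(* [g0] is the one labelling that passes the check, so the projection retains a single summand, the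
   wanted product. *)
pose g0 : {ffun 'I_n -> rstate D} := [ffun i => rrun D nu (fun p => (l p, p \in [set i]))].
have ck (b : {ffun 'I_n -> rstate D}) : check n nu (fun p => (l p, b p)) = (b == g0).
  apply/forallP/eqP => [h|-> i]; last by rewrite /= ffunE.
  by apply/ffunP => i; rewrite [RHS]ffunE (eqP (h i)).
rewrite (bigD1 g0) //= ck eqxx mul1r [X in _ + X]big1 ?addr0 => [|b /negbTE nb].
  by apply: eq_bigr => i _; rewrite ffunE hS.
by rewrite ck nb mul0r.
Qed.
End Weighted.

(** * Classical semantics and unambiguous formulas *)

Fixpoint cfv1 Delta (c : cform Delta) : seq nat :=
  match c with
  | CAtom a => atom_fv1 a
  | CNot c => cfv1 c
  | COr c d => cfv1 c ++ cfv1 d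
  | CEx x c => filter (predC1 x) (cfv1 c)
  | CExS _ c => cfv1 c
  end.

Fixpoint cfv2 Delta (c : cform Delta) : seq nat :=
  match c with
  | CAtom a => atom_fv2 a
  | CNot c => cfv2 c
  | COr c d => cfv2 c ++ cfv2 d
  | CEx _ c => cfv2 c
  | CExS X c => filter (predC1 X) (cfv2 c)
  end.

Lemma cfv1_cvars1 Delta (c : cform Delta) : {subset cfv1 c <= cvars1 c}.
Proof.
elim: c => [a|c IH|c IHc d IHd|x c IH|X c IH] u //=; try exact: IH.
- by rewrite !mem_cat => /orP[/IHc->|/IHd->]; rewrite ?orbT.
- by rewrite mem_filter in_cons => /andP[_ /IH->]; rewrite orbT.
Qed.

Lemma cfv2_cvars2 Delta (c : cform Delta) : {subset cfv2 c <= cvars2 c}.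
Proof.
elim: c => [a|c IH|c IHc d IHd|x c IH|X c IH] u //=; try exact: IH.
- by rewrite !mem_cat => /orP[/IHc->|/IHd->]; rewrite ?orbT.
- by rewrite mem_filter in_cons => /andP[_ /IH->]; rewrite orbT.
Qed.

Section ClassicalSemantics.
Variables (Delta : finType) (nw : nested_word Delta).
Local Notation n := (nw_len nw).

Fixpoint csem (g1 : nat -> 'I_n) (g2 : nat -> {set 'I_n}) (c : cform Delta) : bool :=
  match c with
  | CAtom a => atom_holds g1 g2 a
  | CNot c => ~~ csem g1 g2 c
  | COr c d => csem g1 g2 c || csem g1 g2 d
  | CEx x c => [exists i, csem (upd g1 x i) g2 c]
  | CExS X c => [exists A, csem g1 (upd g2 X A) c]
  end.

Lemma upd_ext (T : Type) (g h : nat -> T) x v (s : seq nat) :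
  {in filter (predC1 x) s, g =1 h} -> {in s, upd g x v =1 upd h x v}.
Proof.
move=> e z zs; rewrite /upd; case: eqP => // /eqP zx.
by rewrite e // mem_filter /= zx.
Qed.

Lemma csem_ext g1 h1 g2 h2 c : {in cfv1 c, g1 =1 h1} -> {in cfv2 c, g2 =1 h2} ->
  csem g1 g2 c = csem h1 h2 c.
Proof.
elim: c g1 h1 g2 h2 => [a|c IH|c IHc d IHd|x c IH|X c IH] g1 h1 g2 h2 /= e1 e2.
- by case: a e1 e2 => [x y|b x|x y|x y|x X] /= e1 e2; rewrite ?e1 ?e2 ?inE ?eqxx ?orbT.
- by rewrite (IH _ h1 _ h2).
- rewrite (IHc _ h1 _ h2) ?(IHd _ h1 _ h2) // => u h; rewrite ?e1 ?e2 //;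
  by rewrite mem_cat h ?orbT.
- by apply/eq_existsb => i; apply: IH => //; apply: upd_ext.
- by apply/eq_existsb => A; apply: IH => //; apply: upd_ext.
Qed.

(** Since [y] is excluded from the bound variables as well, no quantifier captures it. *)
Lemma csem_rename1 g1 g2 x y c : y \notin cvars1 c ->
  csem g1 g2 (crename1 x y c) = csem (upd g1 x (g1 y)) g2 c.
Proof.
have er (h : nat -> 'I_n) z : h (ren x y z) = upd h x (h y) z.
  by rewrite /ren /upd; case: eqP.
elim: c g1 g2 => [a|c IH|c IHc d IHd|z c IH|X c IH] g1 g2 /=.
- by case: a => * /=; rewrite ?er.
- by move=> h; rewrite IH.
- by rewrite mem_cat negb_or => /andP[h h']; rewrite IHc ?IHd.
- rewrite inE negb_or => /andP[nyz nyc]; case: (eqVneq z x) => [ezx|nzx] /=.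
    apply/eq_existsb => i; apply: csem_ext => // u _; rewrite /upd ezx.
    by case: eqP.
  apply/eq_existsb => i; rewrite IH //; apply: csem_ext => // u _; rewrite /upd (negbTE nyz).
  by case: (eqVneq u x) => // ->; rewrite eq_sym (negbTE nzx).
- by move=> h; apply/eq_existsb => A; rewrite IH.
Qed.

Lemma csem_rename2 g1 g2 X Y c : Y \notin cvars2 c ->
  csem g1 g2 (crename2 X Y c) = csem g1 (upd g2 X (g2 Y)) c.
Proof.
have er (h : nat -> {set 'I_n}) z : h (ren X Y z) = upd h X (h Y) z.
  by rewrite /ren /upd; case: eqP.
elim: c g1 g2 => [a|c IH|c IHc d IHd|z c IH|Z c IH] g1 g2 /=.
- by case: a => * /=; rewrite ?er.
- by move=> h; rewrite IH.
- by rewrite mem_cat negb_or => /andP[h h']; rewrite IHc ?IHd.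
- by move=> h; apply/eq_existsb => A; rewrite IH.
- rewrite inE negb_or => /andP[nyz nyc]; case: (eqVneq Z X) => [ezx|nzx] /=.
    apply/eq_existsb => i; apply: csem_ext => // u _; rewrite /upd ezx.
    by case: eqP.
  apply/eq_existsb => i; rewrite IH //; apply: csem_ext => // u _; rewrite /upd (negbTE nyz).
  by case: (eqVneq u X) => // ->; rewrite eq_sym (negbTE nzx).
Qed.

Lemma csem_and g1 g2 c d : csem g1 g2 (cand c d) = csem g1 g2 c && csem g1 g2 d.
Proof. by rewrite /= negb_or !negbK. Qed.

Lemma csem_lt g1 g2 x y : csem g1 g2 (clt x y) = (g1 x < g1 y).
Proof. by rewrite /= ltnNge. Qed.

Definition set_lex (B A : {set 'I_n}) : bool :=
  [exists y, [&& y \in A, y \notin B & [forall z : 'I_n, (z < y) ==> ((z \in A) == (z \in B))]]].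

Lemma csem_ltS g1 g2 Y X : csem g1 g2 (cltS Y X) = set_lex (g2 Y) (g2 X).
Proof.
apply/eq_existsb => y; rewrite /= negb_exists !negb_or !negbK.
congr [&& _, _ & _]; apply: eq_forallb => z.
rewrite /upd /= !negb_or !negbK -ltnNge.
by case: (z \in g2 X); case: (z \in g2 Y); case: (z < y).
Qed.

Lemma set_lex_irr A : ~~ set_lex A A.
Proof. by apply/existsPn => y; case: (y \in A). Qed.

(** The least position at which the two sets differ decides. *)
Lemma set_lex_total A B : A != B -> set_lex A B || set_lex B A.
Proof.
move=> neq; have [x0 nx0] : exists x, (x \in A) != (x \in B).
  apply/existsP; apply: contraR neq => /existsPn h; apply/eqP/setP => x.
  by apply/eqP; have := h x; rewrite negbK.
case: (@arg_minnP _ x0 (fun x => (x \in A) != (x \in B)) val nx0) => y ny miny.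
have low : [forall z : 'I_n, (z < y) ==> ((z \in B) == (z \in A))].
  apply/forallP => z; apply/implyP => lzy; rewrite eq_sym; apply: contraLR lzy => h.
  by rewrite -leqNgt; apply: miny.
case yA: (y \in A) ny => /= ny; apply/orP; [right | left]; apply/existsP; exists y.
  rewrite yA; case: (y \in B) ny => //= _; apply/forallP => z.
  by rewrite eq_sym; apply: (forallP low).
by rewrite yA; case: (y \in B) ny.
Qed.

Lemma set_lex_trans A B C : set_lex A B -> set_lex B C -> set_lex A C.
Proof.
case/existsP=> y /and3P[yB yA /forallP lowy] /existsP[z /and3P[zC zB /forallP lowz]].
have Ey (u : 'I_n) : u < y -> (u \in B) = (u \in A) by move=> h; apply/eqP; apply: (implyP (lowy u)).
have Ez (u : 'I_n) : u < z -> (u \in C) = (u \in B) by move=> h; apply/eqP; apply: (implyP (lowz u)).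
apply/existsP; case: (ltngtP y z) => [lyz|lzy|/val_inj eyz].
- exists y; rewrite Ez // yB yA /=; apply/forallP => u; apply/implyP => lu.
  by rewrite Ez ?Ey // (ltn_trans lu).
- exists z; rewrite zC -Ey // zB /=; apply/forallP => u; apply/implyP => lu.
  by rewrite Ez ?Ey // (ltn_trans lu).
- by rewrite -eyz yB in zB.
Qed.
End ClassicalSemantics.

(** A strict total order on a finite type singles out exactly one least witness if there is any.
    This is why the translated existential quantifiers take only the values 0 and 1. *)
Lemma sum_least (K : comPzSemiRingType) (T : finType) (lt : rel T) (P : pred T) :
  irreflexive lt -> transitive lt -> (forall a b, a != b -> lt a b || lt b a) ->
  (\sum_a (if P a && [forall b, ~~ (lt b a && P b)] then 1 else 0) =
   if [exists a, P a] then 1 else 0 :> K)%R.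
Proof.
move=> irr tr tot; case: ifPn => [/existsP[a0 Pa0]|/existsPn nP]; last first.
  by apply: big1 => a _; rewrite (negbTE (nP a)).
(* A witness with the fewest elements below it is least: a witness below it would have strictly
   fewer. *)
case: (@arg_minnP _ a0 P (fun a => #|[pred b | lt b a]|) Pa0) => a Pa mina.
have least b : P b -> ~~ lt b a.
  move=> Pb; apply/negP => lba; have := mina b Pb; rewrite leqNgt => /negP; apply.
  apply/proper_card/properP; split.
    by apply/subsetP => c; rewrite !inE => /tr; apply.
  by exists b; rewrite !inE ?irr.
rewrite (bigD1 a) //= Pa (_ : [forall b, _]) /=; last first.
  by apply/forallP => b; apply/negP => /andP[h /least]; rewrite h.
rewrite big1 ?addr0 // => b nba; case: ifP => // /andP[Pb /forallP /(_ a)].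
by rewrite Pa andbT => nab; have := tot _ _ nba; rewrite (negbTE nab) (negbTE (least _ Pb)).
Qed.

Lemma foldr_maxn_notin x0 (s : seq nat) : (foldr maxn x0 s).+1 \notin s.
Proof.
suff h z : z \in s -> z <= foldr maxn x0 s by apply/negP => /h; rewrite ltnn.
elim: s => //= y s IH; rewrite inE leq_max => /orP[/eqP->|/IH->]; by rewrite ?leqnn ?orbT.
Qed.

Lemma foldr_maxn_neq x0 (s : seq nat) : (foldr maxn x0 s).+1 != x0.
Proof.
suff h : x0 <= foldr maxn x0 s by rewrite neq_ltn ltnS h orbT.
by elim: s => //= y s IH; rewrite leq_max IH orbT.
Qed.

Lemma cfv1_rename1 Delta (c : cform Delta) x y u : u != x -> u != y ->
  (u \in cfv1 (crename1 x y c)) = (u \in cfv1 c).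
Proof.
move=> ux uy; have er z : (u == ren x y z) = (u == z).
  by rewrite /ren; case: (eqVneq z x) => // ->; rewrite (negbTE ux) (negbTE uy).
elim: c => [a|c IH|c IHc d IHd|z c IH|X c IH] //=.
- by case: a => * /=; rewrite !inE ?er.
- by rewrite !mem_cat IHc IHd.
- by case: eqP => //= _; rewrite !mem_filter IH.
Qed.

Lemma cfv2_rename1 Delta (c : cform Delta) x y : cfv2 (crename1 x y c) = cfv2 c.
Proof.
elim: c => [a|c IH|c IHc d IHd|z c IH|X c IH] //=; last by rewrite IH.
- by case: a.
- by rewrite IHc IHd.
- by case: eqP.
Qed.

Lemma cfv1_rename2 Delta (c : cform Delta) x y : cfv1 (crename2 x y c) = cfv1 c.
Proof.
elim: c => [a|c IH|c IHc d IHd|z c IH|X c IH] //=; try by rewrite IH.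
- by case: a.
- by rewrite IHc IHd.
- by case: eqP.
Qed.

Lemma cfv2_rename2 Delta (c : cform Delta) x y u : u != x -> u != y ->
  (u \in cfv2 (crename2 x y c)) = (u \in cfv2 c).
Proof.
move=> ux uy; have er z : (u == ren x y z) = (u == z).
  by rewrite /ren; case: (eqVneq z x) => // ->; rewrite (negbTE ux) (negbTE uy).
elim: c => [a|c IH|c IHc d IHd|z c IH|X c IH] //=.
- by case: a => * /=; rewrite ?inE ?er.
- by rewrite !mem_cat IHc IHd.
- by case: eqP => //= _; rewrite !mem_filter IH.
Qed.

Lemma pm_fv Delta K (c : cform Delta) (p m : wform Delta K) : pm c p m ->
  [/\ wfv1 p =i cfv1 c, wfv1 m =i cfv1 c, wfv2 p =i cfv2 c & wfv2 m =i cfv2 c].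
Proof.
elim=> {c p m} [a|c p m _ []|c d p m p' m' _ [a1 a2 a3 a4] _ [b1 b2 b3 b4]|
  x c p m p2 m2 _ [a1 a2 a3 a4] _ [b1 b2 b3 b4]|X c p m p2 m2 _ [a1 a2 a3 a4] _ [b1 b2 b3 b4]].
- by [].
- by move=> *; split.
- split=> u; rewrite /= !mem_cat ?a1 ?a2 ?a3 ?a4 ?b1 ?b2 ?b3 ?b4 //.
    by case: (_ \in _).
  by case: (_ \in _).
- split=> u /=.
  + rewrite !mem_filter mem_cat mem_filter /= a1 b2.
    case: (eqVneq u x) => //= ux; case: (eqVneq u (fresh1 x c)) => /= [|uy]; first by rewrite orbF.
    rewrite !inE (negbTE ux) (negbTE uy) /= cfv1_rename1 //.
    by case: (_ \in _).
  + by rewrite !mem_filter a2.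
  + by rewrite mem_cat a3 b4 /= cfv2_rename1 orbb.
  + by rewrite a4.
- split=> u /=.
  + by rewrite mem_cat a1 b2 /= cfv1_rename2 orbb.
  + by rewrite a2.
  + rewrite !mem_filter mem_cat mem_filter /= a3 b4.
    case: (eqVneq u X) => //= ux; case: (eqVneq u (fresh2 X c)) => /= [|uy]; first by rewrite orbF.
    rewrite !inE (negbTE ux) (negbTE uy) /= cfv2_rename2 //.
    by case: (_ \in _).
  + by rewrite !mem_filter a4.
Qed.

(** The induction is on the derivation of [pm], because its quantifier rules recur into a formula
    containing a renamed copy of the body, which is not a subformula. *)
Lemma pm_sem (Delta : finType) (K : comPzSemiRingType) (c : cform Delta)
    (p m : wform Delta K) : pm c p m -> forall (nw : nested_word Delta) g1 g2,
  wsem (nw := nw) g1 g2 p = (if csem g1 g2 c then 1 else 0)%R /\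
  wsem (nw := nw) g1 g2 m = (if csem g1 g2 c then 0 else 1)%R.
Proof.
have neg (b : bool) : (if b then 0 else 1 : K)%R = (if ~~ b then 1 else 0)%R by case: b.
elim=> {c p m} [a|c p m _ IH|c d p m p' m' _ IH _ IH'|x c p m p2 m2 _ IH _ IH2|
   X c p m p2 m2 _ IH _ IH2] nw g1 g2 //=.
- by have [-> ->] := IH nw g1 g2; case: csem.
- have [-> ->] := IH nw g1 g2; have [-> ->] := IH' nw g1 g2.
  by case: csem; case: csem; rewrite /= ?mul0r ?mul1r ?mulr0 ?addr0 ?add0r.
- have sm : (\prod_(i : 'I_(nw_len nw)) wsem (upd g1 x i) g2 m)%R =
            (if [exists i, csem (upd g1 x i) g2 c] then 0 else 1)%R :> K.
    rewrite (eq_bigr (fun i => if ~~ csem (upd g1 x i) g2 c then 1 else 0)%R); last first.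
      by move=> i _; rewrite (IH nw _ _).2 neg.
    by rewrite prod_indicator neg negb_exists.
  split=> //; rewrite -(@sum_least _ _ (fun i j : 'I_(nw_len nw) => i < j)).
  + apply: eq_bigr => i _; rewrite (IH nw _ _).1; set y := fresh1 x c.
    rewrite (eq_bigr (fun j : 'I_(nw_len nw) =>
        if ~~ ((j < i)%N && csem (upd g1 x j) g2 c) then 1 else 0)%R); last first.
      move=> j _; rewrite (IH2 nw _ _).2 neg csem_and csem_lt csem_rename1 ?foldr_maxn_notin //.
      have nyx : (x == y) = false by apply/negbTE; rewrite eq_sym foldr_maxn_neq.
      congr (if ~~ (_ && _) then _ else _); first by rewrite /upd !eqxx nyx.
      apply: csem_ext => // u /cfv1_cvars1 uc; rewrite /upd eqxx.
      case: eqP => // _; case: eqP => // uy.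
      by have := foldr_maxn_notin x (cvars1 c); rewrite -[_.+1]/y -uy uc.
    by rewrite prod_indicator; case: csem; rewrite ?mul1r ?mul0r.
  + by move=> i; rewrite ltnn.
  + by move=> i j k; apply: ltn_trans.
  + by move=> i j; rewrite -neq_ltn.
- have sm : (\prod_(A : {set 'I_(nw_len nw)}) wsem g1 (upd g2 X A) m)%R =
            (if [exists A, csem g1 (upd g2 X A) c] then 0 else 1)%R :> K.
    rewrite (eq_bigr (fun A => if ~~ csem g1 (upd g2 X A) c then 1 else 0)%R); last first.
      by move=> A _; rewrite (IH nw _ _).2 neg.
    by rewrite prod_indicator neg negb_exists.
  split=> //; rewrite -(@sum_least _ _ (@set_lex _ nw)).
  + apply: eq_bigr => A _; rewrite (IH nw _ _).1; set Y := fresh2 X c.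
    rewrite (eq_bigr (fun B =>
        if ~~ (set_lex B A && csem g1 (upd g2 X B) c) then 1 else 0)%R); last first.
      move=> B _; rewrite (IH2 nw _ _).2 neg csem_and csem_ltS csem_rename2 ?foldr_maxn_notin //.
      have nyx : (X == Y) = false by apply/negbTE; rewrite eq_sym foldr_maxn_neq.
      congr (if ~~ (_ && _) then _ else _); first by rewrite /upd !eqxx nyx.
      apply: csem_ext => // u /cfv2_cvars2 uc; rewrite /upd eqxx.
      case: eqP => // _; case: eqP => // uy.
      by have := foldr_maxn_notin X (cvars2 c); rewrite -[_.+1]/Y -uy uc.
    by rewrite prod_indicator; case: csem; rewrite ?mul1r ?mul0r.
  + by move=> A; apply/negbTE/set_lex_irr.
  + by move=> B A C; apply: set_lex_trans.
  + exact: set_lex_total.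
Qed.

(** * From formulas to automata *)

(* How the letters of [Sigma] encode a letter of [Delta] and the values of the
   variables at a position. *)
Record reader (Delta Sigma : Type) := Reader {
  rlab : Sigma -> Delta;
  rvar1 : nat -> Sigma -> bool;
  rvar2 : nat -> Sigma -> bool }.

Definition encodes (Delta : finType) (Sigma : Type) (rd : reader Delta Sigma) (V1 V2 : seq nat)
    (nw : nested_word Delta) (g1 : nat -> 'I_(nw_len nw)) (g2 : nat -> {set 'I_(nw_len nw)})
    (l : 'I_(nw_len nw) -> Sigma) : Prop :=
  [/\ forall p, rlab rd (l p) = tnth (nw_word nw) p,
      {in V1, forall x p, rvar1 rd x (l p) = (p == g1 x)} &
      {in V2, forall X p, rvar2 rd X (l p) = (p \in g2 X)}].

(** The new bit shadows an older track of the same variable, as a repeated quantifier requires. *)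
Definition mark1 (Delta Sigma : Type) (rd : reader Delta Sigma) (x : nat) :
    reader Delta (Sigma * bool) :=
  Reader (fun a => rlab rd a.1) (fun z a => if z == x then a.2 else rvar1 rd z a.1)
    (fun Z a => rvar2 rd Z a.1).

Definition mark2 (Delta Sigma : Type) (rd : reader Delta Sigma) (X : nat) :
    reader Delta (Sigma * bool) :=
  Reader (fun a => rlab rd a.1) (fun z a => rvar1 rd z a.1)
    (fun Z a => if Z == X then a.2 else rvar2 rd Z a.1).

Definition valued (Delta : finType) (V : Type) :=
  forall nw : nested_word Delta, (nat -> 'I_(nw_len nw)) -> (nat -> {set 'I_(nw_len nw)}) -> V.

Section Encoding.
Variables (Delta : finType) (nw : nested_word Delta).
Variables (g1 : nat -> 'I_(nw_len nw)) (g2 : nat -> {set 'I_(nw_len nw)}).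
Variables (Sigma : Type) (rd : reader Delta Sigma) (l : 'I_(nw_len nw) -> Sigma).

Lemma encodes_sub (V1 V2 W1 W2 : seq nat) : {subset V1 <= W1} -> {subset V2 <= W2} ->
  encodes rd W1 W2 g1 g2 l -> encodes rd V1 V2 g1 g2 l.
Proof. by move=> s1 s2 [hl h1 h2]; split=> // x; [move/s1/h1 | move/s2/h2]. Qed.

Lemma encodes_mark1 (V1 V2 : seq nat) x i : encodes rd (filter (predC1 x) V1) V2 g1 g2 l ->
  encodes (mark1 rd x) V1 V2 (upd g1 x i) g2 (fun p => (l p, p \in [set i])).
Proof.
case=> hl h1 h2; split=> // z zV p /=; rewrite /upd; case: eqP => [_|/eqP zx].
  by rewrite inE.
by rewrite h1 // mem_filter /= zx.
Qed.

Lemma encodes_mark2 (V1 V2 : seq nat) X A : encodes rd V1 (filter (predC1 X) V2) g1 g2 l ->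
  encodes (mark2 rd X) V1 V2 g1 (upd g2 X A) (fun p => (l p, p \in A)).
Proof.
case=> hl h1 h2; split=> // z zV p /=; rewrite /upd; case: eqP => [//|/eqP zx].
by rewrite h2 // mem_filter /= zx.
Qed.
End Encoding.

Section FinRep.
Variable Delta : finType.

(** Quantifying over all alphabets and readers lets an induction pass to [Sigma * bool] under a
    quantifier without fixing in advance which variables have tracks. *)
Definition finrep (V : Type) (V1 V2 : seq nat) (F : valued Delta V) : Prop :=
  forall (Sigma : finType) (rd : reader Delta Sigma),
    exists2 S : nseries Sigma V, finrec S &
      forall nw g1 g2 l, encodes rd V1 V2 g1 g2 l -> S _ (nw_nu nw) l = F nw g1 g2.

Lemma finrep_sub (V : Type) (V1 V2 W1 W2 : seq nat) (F : valued Delta V) :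
  {subset V1 <= W1} -> {subset V2 <= W2} -> finrep V1 V2 F -> finrep W1 W2 F.
Proof.
move=> s1 s2 hF Sigma rd; have [S fS hS] := hF Sigma rd.
by exists S => // nw g1 g2 l /(encodes_sub s1 s2)/hS.
Qed.

Lemma finrep_ext (V : Type) (V1 V2 : seq nat) (F G : valued Delta V) :
  (forall nw g1 g2, F nw g1 g2 = G nw g1 g2) -> finrep V1 V2 F -> finrep V1 V2 G.
Proof.
move=> e hF Sigma rd; have [S fS hS] := hF Sigma rd.
by exists S => // nw g1 g2 l /hS; rewrite e.
Qed.

Lemma finrep_const (V : Type) (v : V) : finrep [::] [::] (fun _ _ _ => v).
Proof.
by move=> Sigma rd; exists (fun _ _ _ => v) => //; apply: finrec_const.
Qed.

Lemma finrep_map (V W : Type) (g : V -> W) V1 V2 (F : valued Delta V) :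
  finrep V1 V2 F -> finrep V1 V2 (fun nw g1 g2 => g (F nw g1 g2)).
Proof.
move=> hF Sigma rd; have [S fS hS] := hF Sigma rd.
exists (fun n nu l => g (S n nu l)); first exact: finrec_map.
by move=> nw g1 g2 l /hS ->.
Qed.

Lemma finrep_map2 (V W U : Type) (op : V -> W -> U) V1 V2 W1 W2
    (F : valued Delta V) (G : valued Delta W) :
  finrep V1 V2 F -> finrep W1 W2 G ->
  finrep (V1 ++ W1) (V2 ++ W2) (fun nw g1 g2 => op (F nw g1 g2) (G nw g1 g2)).
Proof.
move=> hF hG Sigma rd; have [S fS hS] := hF Sigma rd; have [T fT hT] := hG Sigma rd.
exists (fun n nu l => op (S n nu l) (T n nu l)); first exact: finrec_map2.
have subl (s t : seq nat) : {subset s <= s ++ t} by move=> x xs; rewrite mem_cat xs.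
have subr (s t : seq nat) : {subset t <= s ++ t} by move=> x xs; rewrite mem_cat xs orbT.
move=> nw g1 g2 l h; rewrite (hS nw g1 g2); last exact: encodes_sub h.
by rewrite (hT nw g1 g2) //; apply: encodes_sub h.
Qed.

Lemma finrep_big1 (V : Type) (idx : V) (op : Monoid.com_law idx) V1 V2 x (F : valued Delta V) :
  eventually_periodic op idx -> finrep V1 V2 F ->
  finrep (filter (predC1 x) V1) V2
    (fun nw g1 g2 => \big[op/idx]_(i < nw_len nw) F nw (upd g1 x i) g2).
Proof.
move=> per hF Sigma rd; have [S fS hS] := hF (Sigma * bool)%type (mark1 rd x).
eexists; first exact: finrec_big1 per fS.
by move=> nw g1 g2 l h; apply: eq_bigr => i _; apply: hS; apply: encodes_mark1.
Qed.

Lemma finrep_bigS (V : Type) (idx : V) (op : Monoid.com_law idx) V1 V2 X (F : valued Delta V) :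
  eventually_periodic op idx -> finrep V1 V2 F ->
  finrep V1 (filter (predC1 X) V2)
    (fun nw g1 g2 => \big[op/idx]_(A : {set 'I_(nw_len nw)}) F nw g1 (upd g2 X A)).
Proof.
move=> per hF Sigma rd; have [S fS hS] := hF (Sigma * bool)%type (mark2 rd X).
eexists; first exact: finrec_big per fS.
by move=> nw g1 g2 l h; apply: eq_bigr => A _; apply: hS; apply: encodes_mark2.
Qed.

Lemma finrep_atom (a : atom Delta) :
  finrep (atom_fv1 a) (atom_fv2 a) (fun nw g1 g2 => atom_holds g1 g2 a).
Proof.
case: a => [x y|b x|x y|x y|x X] Sigma rd /=.
- eexists; first exact: (finrec_exists (fun a => rvar1 rd x a && rvar1 rd y a)).
  move=> nw g1 g2 l [_ h1 _] /=; apply/existsP/eqP => [[p]|e].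
    by rewrite !h1 ?inE ?eqxx ?orbT // => /andP[/eqP<- /eqP].
  by exists (g1 x); rewrite !h1 ?inE ?eqxx ?orbT //= e eqxx.
- eexists; first exact: (finrec_exists (fun a => rvar1 rd x a && (rlab rd a == b))).
  move=> nw g1 g2 l [h h1 _] /=; apply/existsP/idP => [[p]|e].
    by rewrite h1 ?inE ?eqxx // h => /andP[/eqP->].
  by exists (g1 x); rewrite h1 ?inE ?eqxx // h.
- eexists; first exact: (finrec_before (rvar1 rd x) (rvar1 rd y)).
  move=> nw g1 g2 l [_ h1 _] /=; apply/existsP/idP => [[p /existsP[q]]|e].
    by rewrite !h1 ?inE ?eqxx ?orbT // => /and3P[lpq /eqP<- /eqP<-].
  by exists (g1 x); apply/existsP; exists (g1 y); rewrite e !h1 ?inE ?eqxx ?orbT.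
- eexists; first exact: (finrec_nu (rvar1 rd x) (rvar1 rd y)).
  move=> nw g1 g2 l [_ h1 _] /=; apply/existsP/idP => [[p /existsP[q]]|e].
    by rewrite !h1 ?inE ?eqxx ?orbT // => /and3P[lpq /eqP<- /eqP<-].
  by exists (g1 x); apply/existsP; exists (g1 y); rewrite e !h1 ?inE ?eqxx ?orbT.
- eexists; first exact: (finrec_exists (fun a => rvar1 rd x a && rvar2 rd X a)).
  move=> nw g1 g2 l [_ h1 h2] /=; apply/existsP/idP => [[p]|e].
    by rewrite h1 ?h2 ?inE ?eqxx // => /andP[/eqP->].
  by exists (g1 x); rewrite h1 ?h2 ?inE ?eqxx.
Qed.

Lemma finrep_csem (c : cform Delta) :
  finrep (cfv1 c) (cfv2 c) (fun nw g1 g2 => csem g1 g2 c).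
Proof.
elim: c => [a|c IH|c IHc d IHd|x c IH|X c IH] /=.
- exact: finrep_atom.
- exact: finrep_map IH.
- exact: finrep_map2 IHc IHd.
- apply: finrep_ext (finrep_big1 (op := orb) x orb_eventually_periodic IH) => nw g1 g2.
  by rewrite big_orE.
- apply: finrep_ext (finrep_bigS (op := orb) X orb_eventually_periodic IH) => nw g1 g2.
  by rewrite big_orE.
Qed.
End FinRep.

(** * Weighted formulas and local finiteness *)

Section Logic.
Variables (Delta : finType) (K : comPzSemiRingType).
Local Notation wf := (wform Delta K).
Local Open Scope ring_scope.

Definition wfinrep (phi : wf) : Prop :=
  finrep (wfv1 phi) (wfv2 phi) (fun nw g1 g2 => wsem g1 g2 phi).

Lemma syn_unamb_finrep phi : syn_unamb phi -> wfinrep phi.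
Proof.
case=> c [p [m [h e]]]; have [f1 f2 f3 f4] := pm_fv h; have sem := pm_sem h.
rewrite /wfinrep; case: e => ->.
  apply: (finrep_sub (V1 := cfv1 c) (V2 := cfv2 c)); try by move=> u; rewrite ?f1 ?f3.
  apply: finrep_ext (finrep_map (fun b : bool => if b then 1 else 0) (finrep_csem c)).
  by move=> nw g1 g2; rewrite (sem nw _ _).1.
apply: (finrep_sub (V1 := cfv1 c) (V2 := cfv2 c)); try by move=> u; rewrite ?f2 ?f4.
apply: finrep_ext (finrep_map (fun b : bool => if b then 0 else 1) (finrep_csem c)).
by move=> nw g1 g2; rewrite (sem nw _ _).2.
Qed.

Lemma aUMSO_finrep phi : aUMSO phi -> wfinrep phi.
Proof.
elim=> {phi} [k|phi|a b _ IHa _ IHb|a b _ IHa _ IHb].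
- exact: finrep_const.
- exact: syn_unamb_finrep.
- exact: finrep_map2 IHa IHb.
- exact: finrep_map2 IHa IHb.
Qed.

(** Two of the first [(size t).+1] iterates agree, at indices [i < j <= size t]. The factorial
    bounds [i] and is a multiple of the period [j - i]; it depends on [t] alone and so serves all
    [g] at once. *)
Lemma iter_eventually_periodic (V : eqType) (t : seq V) (g : V -> V) (v : V) :
  (forall n, iter n g v \in t) ->
  forall n, ((size t)`! <= n)%N -> iter (n + (size t)`!) g v = iter n g v.
Proof.
move=> ht; set N := size t; pose s := [seq iter k g v | k <- iota 0 N.+1].
have : ~~ uniq s.
  apply/negP => us; have := uniq_leq_size us (s2 := t).
  rewrite size_map size_iota ltnn => h; suff: false by [].
  by apply: h => _ /mapP[k _ ->].
case/(uniqPn v) => i [j [lij]]; rewrite size_map size_iota => ljN.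
rewrite !(nth_map 0%N) ?size_iota // ?(ltn_trans lij) // !nth_iota ?(ltn_trans lij) //.
rewrite !add0n => eij.
have per k n : (i <= n)%N -> iter (n + k * (j - i)) g v = iter n g v.
  move=> lin; elim: k => [|k IH]; first by rewrite addn0.
  have -> : (n + k.+1 * (j - i) = (n - i + k * (j - i)) + j)%N by rewrite mulSn; lia.
  have e : (n + k * (j - i) = (n - i + k * (j - i)) + i)%N by lia.
  by rewrite iterD -eij -iterD -e.
have iN : (i <= N`!)%N.
  apply: leq_trans (fact_geq _); exact: leq_trans (ltnW lij) _.
move=> n lNn; have /dvdnP[c ->] : (j - i %| N`!)%N.
  by apply: dvdn_fact; rewrite subn_gt0 lij /= (leq_trans (leq_subr _ _)).
by apply: per; apply: leq_trans lNn.
Qed.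

Lemma add_loc_finite_periodic : add_loc_finite K -> eventually_periodic (@GRing.add K) 0.
Proof.
move=> lf Q f; have [t [st t0 tD]] := lf (codom f).
exists (size t)`!; first exact: fact_gt0.
move=> q; apply: iter_eventually_periodic; elim=> //= n IH; apply: tD => //.
exact/st/codom_f.
Qed.

Lemma loc_finite_add : loc_finite K -> add_loc_finite K.
Proof. by move=> lf s; have [t [st t0 t1 tD tM]] := lf s; exists t. Qed.

Lemma loc_finite_mul_periodic : loc_finite K -> eventually_periodic (@GRing.mul K) 1.
Proof.
move=> lf Q f; have [t [st t0 t1 tD tM]] := lf (codom f).
exists (size t)`!; first exact: fact_gt0.
move=> q; apply: iter_eventually_periodic; elim=> //= n IH; apply: tM => //.
exact/st/codom_f.
Qed.

Lemma wUMSO_finrep : add_loc_finite K -> forall phi, wUMSO phi -> wfinrep phi.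
Proof.
move/add_loc_finite_periodic => per phi.
elim=> {phi} [k|phi|a b _ IHa _ IHb|a b _ IHa _ IHb|x a _ IH|X a _ IH].
- exact: finrep_const.
- exact: syn_unamb_finrep.
- exact: finrep_map2 IHa IHb.
- exact: finrep_map2 IHa IHb.
- exact: (finrep_big1 (op := +%R) x per IH).
- exact: (finrep_bigS (op := +%R) X per IH).
Qed.

Lemma loc_finite_finrep : loc_finite K -> forall phi, wfinrep phi.
Proof.
move=> lf; have perD := add_loc_finite_periodic (loc_finite_add lf).
have perM := loc_finite_mul_periodic lf.
elim=> [k|a|a|a IHa b IHb|a IHa b IHb|x a IH|X a IH|x a IH|X a IH].
- exact: finrep_const.
- exact: (finrep_map (fun b : bool => if b then 1 else 0) (finrep_atom a)).
- exact: (finrep_map (fun b : bool => if b then 0 else 1) (finrep_atom a)).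
- exact: finrep_map2 IHa IHb.
- exact: finrep_map2 IHa IHb.
- exact: (finrep_big1 (op := +%R) x perD IH).
- exact: (finrep_bigS (op := +%R) X perD IH).
- exact: (finrep_big1 (op := *%R) x perM IH).
- exact: (finrep_bigS (op := *%R) X perM IH).
Qed.

Definition wregrep (V1 V2 : seq nat) (F : valued Delta K) : Prop :=
  forall (Sigma : finType) (rd : reader Delta Sigma),
    exists2 S : nseries Sigma K, wregular S &
      forall nw g1 g2 l, encodes rd V1 V2 g1 g2 l -> S _ (nw_nu nw) l = F nw g1 g2.

Lemma finrep_wregrep V1 V2 F : finrep V1 V2 F -> wregrep V1 V2 F.
Proof.
move=> hF Sigma rd; have [S fS hS] := hF Sigma rd; exists S => //.
exact: finrec_wregular.
Qed.

(** The parameter [P] describes the admissible bodies of first-order universal quantifiers, the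
    place where [wregular_forall] needs a finite-state series. *)
Lemma restricted_wregrep (P : wf -> Prop) phi : (forall psi, P psi -> wfinrep psi) ->
  restricted P phi -> wregrep (wfv1 phi) (wfv2 phi) (fun nw g1 g2 => wsem g1 g2 phi).
Proof.
move=> hP.
have subl (s t : seq nat) : {subset s <= s ++ t} by move=> x xs; rewrite mem_cat xs.
have subr (s t : seq nat) : {subset t <= s ++ t} by move=> x xs; rewrite mem_cat xs orbT.
elim: phi => [k|a|a|a IHa b IHb|a IHa b IHb|x a IH|X a IH|x a IH|X a IH] /=.
- by move=> _; apply/finrep_wregrep/finrep_const.
- move=> _; apply/finrep_wregrep.
  exact: (finrep_map (fun b : bool => if b then 1 else 0) (finrep_atom a)).
- move=> _; apply/finrep_wregrep.
  exact: (finrep_map (fun b : bool => if b then 0 else 1) (finrep_atom a)).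
- case=> /IHa{}IHa /IHb{}IHb Sigma rd.
  have [S rS hS] := IHa _ rd; have [T rT hT] := IHb _ rd.
  eexists; first exact: wregular_add rS rT.
  move=> nw g1 g2 l h /=; rewrite (hS _ g1 g2) ?(hT _ g1 g2) //; exact: encodes_sub h.
- case=> /IHa{}IHa /IHb{}IHb Sigma rd.
  have [S rS hS] := IHa _ rd; have [T rT hT] := IHb _ rd.
  eexists; first exact: wregular_mul rS rT.
  move=> nw g1 g2 l h /=; rewrite (hS _ g1 g2) ?(hT _ g1 g2) //; exact: encodes_sub h.
(* A sum over positions is a sum over sets weighted by the indicator of singletons. *)
- move=> /IH{}IH Sigma rd; have [S rS hS] := IH (Sigma * bool)%type (mark1 rd x).
  have := finrec_single (fun a : Sigma * bool => a.2).
  move/(finrec_map (fun b : bool => if b then 1 else 0 : K))/finrec_wregular => rI.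
  eexists; first exact: wregular_sum_sets (wregular_mul rI rS).
  move=> nw g1 g2 l h /=.
  rewrite (bigID (mem [set [set i] | i in 'I_(nw_len nw)])) /= [X in _ + X]big1 ?addr0.
    rewrite big_imset /=; last by move=> i j _ _ /set1_inj.
    apply: eq_bigr => i _.
    rewrite (_ : [set p | p \in _] = [set i]); last by apply/setP => p; rewrite !inE.
    by rewrite cards1 mul1r (hS _ (upd g1 x i) g2) //; apply: encodes_mark1.
  move=> A nA; rewrite ifF ?mul0r //; apply/negbTE; apply: contra nA => /cards1P[i e].
  by apply/imsetP; exists i => //; rewrite -e; apply/setP => p; rewrite inE.
- move=> /IH{}IH Sigma rd; have [S rS hS] := IH (Sigma * bool)%type (mark2 rd X).
  eexists; first exact: wregular_sum_sets rS.
  by move=> nw g1 g2 l h /=; apply: eq_bigr => A _; apply: hS; apply: encodes_mark2.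
- case=> /hP fa _ Sigma rd; have [S fS hS] := fa (Sigma * bool)%type (mark1 rd x).
  eexists; first exact: wregular_forall fS.
  by move=> nw g1 g2 l h /=; apply: eq_bigr => i _; apply: hS; apply: encodes_mark1.
(* The body takes only the values 0 and 1, so its product over all sets is a Boolean conjunction,
   finite-state over any [K]. Below, [g] tells the positive from the negative translation. *)
- case=> su _; apply: finrep_wregrep.
  case: su => c [p [m [h e]]]; have [f1 f2 f3 f4] := pm_fv h; have sem := pm_sem h.
  have [g hg [V1 V2]] : exists2 g : bool -> bool,
      forall nw g1 g2, wsem (nw := nw) g1 g2 a = (if g (csem g1 g2 c) then 1 else 0) :> K &
      {subset cfv1 c <= wfv1 a} /\ {subset cfv2 c <= wfv2 a}.
    case: e => ->.
      exists id; first by move=> nw g1 g2; rewrite (sem nw _ _).1.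
      by split=> u; rewrite ?f1 ?f3.
    exists negb; first by move=> nw g1 g2; rewrite (sem nw _ _).2; case: csem.
    by split=> u; rewrite ?f2 ?f4.
  have fa : finrep (wfv1 a) (wfv2 a) (fun nw g1 g2 => g (csem g1 g2 c)).
    exact: finrep_sub V1 V2 (finrep_map g (finrep_csem c)).
  have := finrep_map (fun b : bool => if b then 1 else 0 : K)
    (finrep_bigS (op := andb) X andb_eventually_periodic fa).
  apply: finrep_ext => nw g1 g2; rewrite big_andE -prod_indicator.
  by apply: eq_bigr => A _; rewrite hg.
Qed.

Lemma wregrep_regular (phi : wf) (S : nested_word Delta -> K) :
  wregrep (wfv1 phi) (wfv2 phi) (fun nw g1 g2 => wsem g1 g2 phi) ->
  sentence phi -> (forall nw, sentence_sem nw phi = S nw) -> regular S.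
Proof.
move=> hphi [f1 f2] hS; rewrite f1 f2 in hphi.
have [T [A hA] hT] := hphi Delta (Reader id (fun _ _ => false) (fun _ _ => false)).
exists (wstate A), (@winit _ _ A), (@wcall _ _ A), (@wint _ _ A), (@wret _ _ A), (@wfinal _ _ A).
move=> nw; rewrite -hS -[RHS](hT _ _ _ (tnth (nw_word nw))) //.
by rewrite -hA //; apply: nw_nest.
Qed.
End Logic.

(** * From automata to formulas *)

Section FirstOrder.
Variable Delta : finType.

Fixpoint first_order (c : cform Delta) : bool :=
  match c with
  | CAtom _ => true
  | CNot c | CEx _ c => first_order c
  | COr c d => first_order c && first_order d
  | CExS _ _ => false
  end.

Lemma first_order_rename1 x y (c : cform Delta) :
  first_order (crename1 x y c) = first_order c.
Proof. by elim: c => //= [c -> d ->|z c IH] //; case: eqP. Qed.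

Fixpoint csize (c : cform Delta) : nat :=
  match c with
  | CAtom _ => 0
  | CNot c | CEx _ c | CExS _ c => (csize c).+1
  | COr c d => (csize c + csize d).+1
  end.

Lemma csize_rename1 x y (c : cform Delta) : csize (crename1 x y c) = csize c.
Proof. by elim: c => //= [c ->|c -> d ->|z c IH|X c ->] //; case: eqP => //= _; rewrite IH. Qed.

(** The rule for an existential quantifier also translates a renamed copy of the body, so the
    recursion is on the size, which renaming preserves. *)
Lemma pm_total (K : Type) (c : cform Delta) : first_order c ->
  exists (p m : wform Delta K), pm c p m.
Proof.
have [N] := ubnP (csize c); elim: N c => // N IH [a|c|c d|x c|//] /=.
- by exists (WAtom a), (WNAtom a); constructor.
- by rewrite ltnS => sz /(IH _ sz)[p [m h]]; exists m, p; constructor.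
- move=> sz /andP[/IH[|p [m h]]]; first lia.
  move=> /IH[|p' [m' h']]; first lia.
  by exists (WOr p (WAnd m p')), (WAnd m m'); constructor.
- rewrite ltnS => sz fc; have [p [m h]] := IH _ sz fc.
  have [||p1 [m1 h1]] := IH (crename1 x (fresh1 x c) c); rewrite ?csize_rename1 ?first_order_rename1 //.
  do 2!eexists; apply: pm_ex h _; do 2!constructor; last by constructor; exact: h1.
  by do 3!constructor.
Qed.

(** Each universal quantifier that the translation creates stands over [m] or [m2], themselves
    negative translations and hence in [aUMSO]. *)
Lemma pm_sRFO (K : Type) (c : cform Delta) (p m : wform Delta K) : pm c p m ->
  first_order c -> sRFO p /\ sRFO m.
Proof.
rewrite /sRFO /sRMSO.
elim=> {c p m} [a|c p m _ IH|c d p m p' m' _ IH _ IH'|x c p m p2 m2 h IH h2 IH2|//] //=.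
- by move/IH=> [].
- by case/andP=> /IH[[? ->] [? ->]] /IH'[[? ->] [? ->]].
- move=> fc; have [[r1 n1] [r2 n2]] := IH fc.
  have [|_ [r3 n3]] := IH2; first by rewrite /= first_order_rename1.
  rewrite n1 n2 n3; split; split=> //; last split=> //.
    by split=> //; split=> //; apply: aU_su; do 3!eexists; split; [exact: h2 | right].
  by apply: aU_su; do 3!eexists; split; [exact: h | right].
Qed.

(* Semantic definability: the formulas themselves never need to be displayed. *)
Definition cdef (V1 V2 : seq nat) (B : valued Delta bool) : Prop :=
  exists c, [/\ first_order c, {subset cfv1 c <= V1}, {subset cfv2 c <= V2} &
    forall nw g1 g2, csem g1 g2 c = B nw g1 g2].

Lemma cdef_ext V1 V2 (B C : valued Delta bool) :
  (forall nw g1 g2, B nw g1 g2 = C nw g1 g2) -> cdef V1 V2 B -> cdef V1 V2 C.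
Proof. by move=> e [c [h1 h2 h3 h4]]; exists c; split=> // nw g1 g2; rewrite h4. Qed.

Lemma cdef_atom V1 V2 (a : atom Delta) : {subset atom_fv1 a <= V1} ->
  {subset atom_fv2 a <= V2} -> cdef V1 V2 (fun nw g1 g2 => atom_holds g1 g2 a).
Proof. by move=> s1 s2; exists (CAtom a). Qed.

Lemma cdef_not V1 V2 (B : valued Delta bool) :
  cdef V1 V2 B -> cdef V1 V2 (fun nw g1 g2 => ~~ B nw g1 g2).
Proof. by case=> c [h1 h2 h3 h4]; exists (CNot c); split=> // nw g1 g2 /=; rewrite h4. Qed.

Lemma cdef_or V1 V2 (B C : valued Delta bool) : cdef V1 V2 B -> cdef V1 V2 C ->
  cdef V1 V2 (fun nw g1 g2 => B nw g1 g2 || C nw g1 g2).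
Proof.
case=> c [h1 h2 h3 h4] [d [k1 k2 k3 k4]]; exists (COr c d); split=> /=.
- by rewrite h1 k1.
- by move=> u; rewrite mem_cat => /orP[/h2|/k2].
- by move=> u; rewrite mem_cat => /orP[/h3|/k3].
- by move=> nw g1 g2; rewrite h4 k4.
Qed.

Lemma cdef_and V1 V2 (B C : valued Delta bool) : cdef V1 V2 B -> cdef V1 V2 C ->
  cdef V1 V2 (fun nw g1 g2 => B nw g1 g2 && C nw g1 g2).
Proof.
move=> /cdef_not hB /cdef_not hC; apply: cdef_ext (cdef_not (cdef_or hB hC)) => nw g1 g2.
by rewrite negb_or !negbK.
Qed.

Lemma cdef_ex V1 V2 x (B : valued Delta bool) : cdef (x :: V1) V2 B ->
  cdef V1 V2 (fun nw g1 g2 => [exists i, B nw (upd g1 x i) g2]).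
Proof.
case=> c [h1 h2 h3 h4]; exists (CEx x c); split=> //=.
  by move=> u; rewrite mem_filter => /andP[/= ux /h2]; rewrite inE (negbTE ux).
by move=> nw g1 g2; apply/eq_existsb => i; rewrite h4.
Qed.

Lemma cdef_true V1 V2 : cdef V1 V2 (fun _ _ _ => true).
Proof.
exists (CEx 0 (CAtom (AEq 0 0))); split=> // nw g1 g2 /=.
by apply/existsP; exists (g1 0).
Qed.

Lemma cdef_bool V1 V2 (b : bool) : cdef V1 V2 (fun _ _ _ => b).
Proof. by case: b; [exact: cdef_true | exact: cdef_not (cdef_true _ _)]. Qed.

Lemma cdef_forall V1 V2 (I : finType) (B : I -> valued Delta bool) :
  (forall i, cdef V1 V2 (B i)) ->
  cdef V1 V2 (fun nw g1 g2 => [forall i, B i nw g1 g2]).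
Proof.
move=> h; suff : cdef V1 V2 (fun nw g1 g2 => all (fun i => B i nw g1 g2) (enum I)).
  apply: cdef_ext => nw g1 g2; apply/allP/forallP => k i *; apply: k.
  by rewrite mem_enum.
by elim: (enum I) => [|i s IH] /=; [exact: cdef_true | exact: cdef_and].
Qed.
End FirstOrder.

(** * Closure properties of weighted definability *)

Section Definability.
Variables (Delta : finType) (K : comPzSemiRingType).
Local Open Scope ring_scope.

(** [adef] collects what may stand under a first-order universal quantifier, [rdef] what may stand
    around it; [rdef_forall] leads from the one to the other. *)
Definition adef (V1 V2 : seq nat) (F : valued Delta K) : Prop :=
  exists phi : wform Delta K, [/\ aUMSO phi, sRFO phi, {subset wfv1 phi <= V1},
    {subset wfv2 phi <= V2} & forall nw g1 g2, wsem g1 g2 phi = F nw g1 g2].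

Definition rdef (V1 V2 : seq nat) (F : valued Delta K) : Prop :=
  exists phi : wform Delta K, [/\ sRFO phi, {subset wfv1 phi <= V1},
    {subset wfv2 phi <= V2} & forall nw g1 g2, wsem g1 g2 phi = F nw g1 g2].

Lemma adef_indicator V1 V2 B : cdef V1 V2 B ->
  adef V1 V2 (fun nw g1 g2 => if B nw g1 g2 then 1 else 0).
Proof.
case=> c [fo s1 s2 sem]; have [p [m h]] := pm_total K fo.
have [f1 _ f2 _] := pm_fv h; exists p; split.
- by apply: aU_su; exists c, p, m; split=> //; left.
- exact: (pm_sRFO h fo).1.
- by move=> u; rewrite f1 => /s1.
- by move=> u; rewrite f2 => /s2.
- by move=> nw g1 g2; rewrite (pm_sem h g1 g2).1 sem.
Qed.

Lemma adef_const V1 V2 (k : K) : adef V1 V2 (fun _ _ _ => k).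
Proof. by exists (WConst k); split=> //; apply: aU_const. Qed.

Lemma adef_add V1 V2 F G : adef V1 V2 F -> adef V1 V2 G ->
  adef V1 V2 (fun nw g1 g2 => F nw g1 g2 + G nw g1 g2).
Proof.
case=> a [a1 [a2 a3] a4 a5 a6] [b [b1 [b2 b3] b4 b5 b6]]; exists (WOr a b); split=> /=.
- exact: aU_or.
- by split=> //=; rewrite a3 b3.
- by move=> u; rewrite mem_cat => /orP[/a4|/b4].
- by move=> u; rewrite mem_cat => /orP[/a5|/b5].
- by move=> nw g1 g2; rewrite a6 b6.
Qed.

Lemma adef_mul V1 V2 F G : adef V1 V2 F -> adef V1 V2 G ->
  adef V1 V2 (fun nw g1 g2 => F nw g1 g2 * G nw g1 g2).
Proof.
case=> a [a1 [a2 a3] a4 a5 a6] [b [b1 [b2 b3] b4 b5 b6]]; exists (WAnd a b); split=> /=.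
- exact: aU_and.
- by split=> //=; rewrite a3 b3.
- by move=> u; rewrite mem_cat => /orP[/a4|/b4].
- by move=> u; rewrite mem_cat => /orP[/a5|/b5].
- by move=> nw g1 g2; rewrite a6 b6.
Qed.

Lemma adef_ext V1 V2 (F G : valued Delta K) :
  (forall nw g1 g2, F nw g1 g2 = G nw g1 g2) -> adef V1 V2 F -> adef V1 V2 G.
Proof. by move=> e [a [a1 a2 a3 a4 a5]]; exists a; split=> // nw g1 g2; rewrite a5. Qed.

Lemma adef_sum V1 V2 (I : finType) (F : I -> valued Delta K) :
  (forall i, adef V1 V2 (F i)) -> adef V1 V2 (fun nw g1 g2 => \sum_i F i nw g1 g2).
Proof.
move=> h; elim: (index_enum I) => [|i s IH].
  by apply: adef_ext (adef_const _ _ 0) => nw g1 g2; rewrite big_nil.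
by apply: adef_ext (adef_add (h i) IH) => nw g1 g2; rewrite big_cons.
Qed.

Lemma adef_rdef V1 V2 F : adef V1 V2 F -> rdef V1 V2 F.
Proof. by case=> a [_ a2 a3 a4 a5]; exists a. Qed.

Lemma rdef_ext V1 V2 (F G : valued Delta K) :
  (forall nw g1 g2, F nw g1 g2 = G nw g1 g2) -> rdef V1 V2 F -> rdef V1 V2 G.
Proof. by move=> e [a [a1 a2 a3 a4]]; exists a; split=> // nw g1 g2; rewrite a4. Qed.

Lemma rdef_mul V1 V2 F G : rdef V1 V2 F -> rdef V1 V2 G ->
  rdef V1 V2 (fun nw g1 g2 => F nw g1 g2 * G nw g1 g2).
Proof.
case=> a [[a2 a3] a4 a5 a6] [b [[b2 b3] b4 b5 b6]]; exists (WAnd a b); split=> /=.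
- by split=> //=; rewrite a3 b3.
- by move=> u; rewrite mem_cat => /orP[/a4|/b4].
- by move=> u; rewrite mem_cat => /orP[/a5|/b5].
- by move=> nw g1 g2; rewrite a6 b6.
Qed.

Lemma rdef_sum V1 V2 (I : finType) (F : I -> valued Delta K) :
  (forall i, rdef V1 V2 (F i)) -> rdef V1 V2 (fun nw g1 g2 => \sum_i F i nw g1 g2).
Proof.
move=> h; elim: (index_enum I) => [|i s IH].
  by apply: rdef_ext (adef_rdef (adef_const _ _ 0)) => nw g1 g2; rewrite big_nil.
case: IH => b [[b2 b3] b4 b5 b6]; case: (h i) => a [[a2 a3] a4 a5 a6].
exists (WOr a b); split=> /=.
- by split=> //=; rewrite a3 b3.
- by move=> u; rewrite mem_cat => /orP[/a4|/b4].
- by move=> u; rewrite mem_cat => /orP[/a5|/b5].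
- by move=> nw g1 g2; rewrite a6 b6 big_cons.
Qed.

Lemma rdef_forall V1 V2 x F : adef (x :: V1) V2 F ->
  rdef V1 V2 (fun nw g1 g2 => \prod_(i < nw_len nw) F nw (upd g1 x i) g2).
Proof.
case=> a [a1 [a2 a3] a4 a5 a6]; exists (WAll x a); split=> //=.
  by move=> u; rewrite mem_filter => /andP[/= ux /a4]; rewrite inE (negbTE ux).
by move=> nw g1 g2; apply: eq_bigr => i _; rewrite a6.
Qed.

Definition updl (T : Type) (g : nat -> T) (k : nat) (t : seq T) : nat -> T :=
  fun z => if (k <= z < k + size t)%N then nth (g z) t (z - k) else g z.

Lemma wsem_ext (nw : nested_word Delta) (g1 h1 : nat -> 'I_(nw_len nw)) g2 h2
    (phi : wform Delta K) : g1 =1 h1 -> g2 =1 h2 -> wsem g1 g2 phi = wsem h1 h2 phi.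
Proof.
have ue (T : Type) (g h : nat -> T) x v : g =1 h -> upd g x v =1 upd h x v.
  by move=> e z; rewrite /upd e.
elim: phi g1 h1 g2 h2 => [k|a|a|a IHa b IHb|a IHa b IHb|x a IH|X a IH|x a IH|X a IH]
  g1 h1 g2 h2 e1 e2 //=.
- by case: a => * /=; rewrite ?e1 ?e2.
- by case: a => * /=; rewrite ?e1 ?e2.
- by rewrite (IHa _ h1 _ h2) // (IHb _ h1 _ h2).
- by rewrite (IHa _ h1 _ h2) // (IHb _ h1 _ h2).
- by apply: eq_bigr => i _; apply: IH => //; apply: ue.
- by apply: eq_bigr => i _; apply: IH => //; apply: ue.
- by apply: eq_bigr => i _; apply: IH => //; apply: ue.
- by apply: eq_bigr => i _; apply: IH => //; apply: ue.
Qed.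

Lemma wsem_foldr_exists (nw : nested_word Delta) (g1 : nat -> 'I_(nw_len nw)) g2
    (psi : wform Delta K) k m :
  wsem g1 g2 (foldr WExS psi (iota k m)) =
  \sum_(t : m.-tuple {set 'I_(nw_len nw)}) wsem g1 (updl g2 k t) psi.
Proof.
elim: m k g2 => [|m IH] k g2 /=.
  rewrite (big_pred1 [tuple]) => [|t]; last by apply/esym/eqP; apply: tuple0.
  apply: wsem_ext => // z; rewrite /updl /= addn0; case: ifP => //; lia.
rewrite (eq_bigr _ (fun A _ => IH k.+1 (upd g2 k A))) pair_big /=.
rewrite (reindex (fun t : m.+1.-tuple {set 'I_(nw_len nw)} => (thead t, [tuple of behead t]))) /=.
  apply: eq_bigr => t _; apply: wsem_ext => // z; rewrite /updl /upd.
  case/tupleP: t => A t; rewrite theadE /= !size_tuple.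
  case: (eqVneq z k) => [->|zk]; first by rewrite ltnn /= leqnn subnn ifT //; lia.
  case: ifP => h1; case: ifP => h2 //; [|lia|lia].
  by have -> : (z - k = (z - k.+1).+1)%N by lia.
exists (fun p : {set 'I_(nw_len nw)} * m.-tuple {set 'I_(nw_len nw)} => [tuple of p.1 :: p.2]).
  by move=> t _; rewrite [RHS]tuple_eta.
move=> [A t] _ /=; rewrite theadE; congr (_, _); exact: val_inj.
Qed.
End Definability.

(** * The formula of a weighted automaton *)

Section AutomatonToFormula.
Variables (Delta : finType) (K : comPzSemiRingType) (Q : finType).
Variables (iota0 kappa : Q -> K) (dcall dint : Q -> Delta -> Q -> K)
          (dret : Q -> Q -> Delta -> Q -> K).
Local Open Scope ring_scope.
Local Notation ind b := (if b then 1 else 0 : K).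
Local Notation rk q := (nat_of_ord (enum_rank q)).
Local Notation V2 := (iota 0 #|Q|).

Section Semantics.
Variables (nw : nested_word Delta) (g2 : nat -> {set 'I_(nw_len nw)}).
Local Notation n := (nw_len nw).

(* The set variable of index [rk q] holds the positions before which the
   automaton is in state [q]; the state after the last position is [qn]. *)
Definition in_state (q : Q) (i : 'I_n) : bool :=
  [forall q', (i \in g2 (rk q')) == (q' == q)].

Definition next_state (qn q : Q) (i : 'I_n) : bool :=
  [exists j : 'I_n, (val j == i.+1) && in_state q j] || ((q == qn) && (i.+1 == n)).

Definition first_state (q : Q) : bool := [exists i : 'I_n, (val i == 0%N) && in_state q i].

Definition return_state (q : Q) (i : 'I_n) : bool :=
  [exists j, ((j, i) \in nw_nu nw) && in_state q j].

(** On a valid assignment each indicator leaves at most one summand. If no [q] fits position [i],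
    the outer sum is empty of nonzero terms, and this 0 discards the assignment. *)
Definition weight_at (qn : Q) (i : 'I_n) : K :=
  \sum_q ind (in_state q i) * \sum_q' ind (next_state qn q' i) *
  \sum_a ind (tnth (nw_word nw) i == a) *
   (\sum_q0 ind (return_state q0 i) * dret q q0 a q' +
    ind (~~ [exists j, (j, i) \in nw_nu nw]) *
      (ind [exists j, (i, j) \in nw_nu nw] * dcall q a q' +
       ind (~~ [exists j, (i, j) \in nw_nu nw]) * dint q a q')).

(** A run has one state more than the word has positions; the sum over [qn] supplies the state that
    no set variable can record. *)
Definition run_weight : K :=
  \sum_qn kappa qn * (\sum_q ind (first_state q) * iota0 q) * \prod_(i < n) weight_at qn i.
End Semantics.

Lemma cdef_in_state V1 x q : x \in V1 ->
  cdef V1 V2 (fun (nw : nested_word Delta) g1 g2 => in_state g2 q (g1 x)).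
Proof.
move=> xV; apply: cdef_forall => q'.
have h : cdef V1 V2 (fun (nw : nested_word Delta) g1 g2 => g1 x \in g2 (rk q')).
  apply: (cdef_atom (a := AIn x (rk q'))) => u; rewrite inE => /eqP-> //.
  by rewrite mem_iota ltn_ord.
case: (q' == q); first by apply: cdef_ext h => nw g1 g2; rewrite eqb_id.
by apply: cdef_ext (cdef_not h) => nw g1 g2; rewrite eqbF_neg.
Qed.

Lemma cdef_lt V1 x y : x \in V1 -> y \in V1 ->
  cdef V1 V2 (fun (nw : nested_word Delta) g1 g2 => (g1 x < g1 y)%N).
Proof.
move=> xV yV; have h : cdef V1 V2 (fun (nw : nested_word Delta) g1 g2 => (g1 y <= g1 x)%N).
  by apply: (cdef_atom (a := ALe y x)) => u //; rewrite !inE => /orP[]/eqP->.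
by apply: cdef_ext (cdef_not h) => nw g1 g2; rewrite ltnNge.
Qed.

Lemma cdef_nu V1 x y : x \in V1 -> y \in V1 ->
  cdef V1 V2 (fun (nw : nested_word Delta) g1 g2 => (g1 x, g1 y) \in nw_nu nw).
Proof.
by move=> xV yV; apply: (cdef_atom (a := ANu x y)) => u //; rewrite !inE => /orP[]/eqP->.
Qed.

Lemma cdef_next_state qn q :
  cdef [:: 0%N] V2 (fun (nw : nested_word Delta) g1 g2 => next_state g2 qn q (g1 0%N)).
Proof.
(* The successor is expressed by the order: variable 1 lies above variable 0 with nothing, named by
   variable 2, in between. In [hl], the last position is one with nothing above it. *)
have hs : cdef [:: 1%N; 0%N] V2 (fun (nw : nested_word Delta) g1 g2 =>
    (g1 0 < g1 1)%N && ~~ [exists k : 'I_(nw_len nw), (g1 0 < k)%N && (k < g1 1)%N]).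
  apply: cdef_and; first exact: cdef_lt.
  exact: cdef_not (cdef_ex (cdef_and (@cdef_lt [:: 2; 1; 0]%N 0 2 isT isT)
    (@cdef_lt [:: 2; 1; 0]%N 2 1 isT isT))).
have hl : cdef [:: 0%N] V2 (fun (nw : nested_word Delta) g1 g2 =>
    ~~ [exists k : 'I_(nw_len nw), (g1 0 < k)%N]).
  exact: cdef_not (cdef_ex (@cdef_lt [:: 1; 0]%N 0 1 isT isT)).
apply: cdef_or; last first.
  apply: cdef_and; first exact: cdef_bool.
  apply: cdef_ext hl => nw g1 g2; have := ltn_ord (g1 0); set i := g1 0 => lin.
  apply/existsPn/eqP => [h|e k]; last by have := ltn_ord k; lia.
  case: (ltnP i.+1 (nw_len nw)) => h'; last by lia.
  by have := h (Ordinal h'); rewrite /= leqnn.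
have := cdef_ex (x := 1) (cdef_and hs (cdef_in_state q (mem_head 1%N [:: 0%N]))).
apply: cdef_ext => nw g1 g2; apply/eq_existsb => j; rewrite /upd /=; congr (_ && _).
apply/andP/eqP => [[lij /existsPn h]|e].
  apply/eqP; rewrite eqn_leq lij andbT leqNgt; apply/negP => lt.
  have lk : ((g1 0).+1 < nw_len nw)%N by have := ltn_ord j; lia.
  by have := h (Ordinal lk); rewrite /= leqnn lt.
by split; [lia | apply/existsPn => k; lia].
Qed.

Lemma cdef_first_state V1 q :
  cdef V1 V2 (fun (nw : nested_word Delta) g1 g2 => first_state g2 q).
Proof.
have hz : cdef (0%N :: V1) V2 (fun (nw : nested_word Delta) g1 g2 =>
    ~~ [exists k : 'I_(nw_len nw), (k < g1 0)%N]).
  by apply: cdef_not (cdef_ex (@cdef_lt [:: 1, 0 & V1]%N 1 0 _ _)); rewrite !inE ?eqxx ?orbT.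
have := cdef_ex (x := 0) (cdef_and hz (cdef_in_state q (mem_head 0%N V1))).
apply: cdef_ext => nw g1 g2; apply/eq_existsb => j; rewrite /upd /=; congr (_ && _).
apply/existsPn/eqP => [h|-> k]; last by rewrite ltn0.
by have := h (Ordinal (nw_pos nw)); rewrite /= lt0n negbK => /eqP.
Qed.

Lemma rdef_run_weight :
  rdef [::] V2 (fun (nw : nested_word Delta) g1 g2 => run_weight g2).
Proof.
apply: rdef_sum => qn; apply: rdef_mul.
  apply: adef_rdef; apply: adef_mul; first exact: adef_const.
  apply: adef_sum => q; apply: adef_mul; last exact: adef_const.
  exact: adef_indicator (cdef_first_state _ _).
pose F : valued Delta K := fun nw g1 g2 => weight_at g2 qn (g1 0%N).
suff : adef [:: 0%N] V2 F by move/rdef_forall; apply: rdef_ext => nw g1 g2.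
have call : cdef [:: 0%N] V2 (fun (nw : nested_word Delta) g1 g2 =>
    [exists j, (g1 0%N, j) \in nw_nu nw]).
  exact: cdef_ex (@cdef_nu [:: 1; 0]%N 0 1 isT isT).
apply: adef_sum => q; apply: adef_mul.
  by apply: adef_indicator; apply: cdef_in_state.
apply: adef_sum => q'; apply: adef_mul.
  by apply: adef_indicator; apply: cdef_next_state.
apply: adef_sum => a; apply: adef_mul.
  apply: adef_indicator; apply: (cdef_atom (a := ALab a 0)) => u //.
apply: adef_add.
  apply: adef_sum => q0; apply: adef_mul; last exact: adef_const.
  apply: adef_indicator; exact: cdef_ex (cdef_and (@cdef_nu [:: 1; 0]%N 1 0 isT isT)
    (@cdef_in_state [:: 1; 0]%N 1 q0 isT)).
apply: adef_mul.
  apply: adef_indicator; exact: cdef_not (cdef_ex (@cdef_nu [:: 1; 0]%N 1 0 isT isT)).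
apply: adef_add; apply: adef_mul; try exact: adef_const; apply: adef_indicator => //.
exact: cdef_not.
Qed.

Lemma sum_indicator (I : finType) (b : pred I) (i0 : I) (F : I -> K) :
  b =1 pred1 i0 -> \sum_i ind (b i) * F i = F i0.
Proof.
move=> e; rewrite (bigD1 i0) //= e /= eqxx mul1r big1 ?addr0 // => i /negbTE ne.
by rewrite e /= ne mul0r.
Qed.

Section Runs.
Variable nw : nested_word Delta.
Local Notation n := (nw_len nw).

Definition states_tuple (f : {ffun 'I_n -> Q}) : #|Q|.-tuple {set 'I_n} :=
  [tuple [set p | f p == enum_val i] | i < #|Q|].

Definition run_of (qn : Q) (f : {ffun 'I_n -> Q}) : {ffun 'I_n.+1 -> Q} :=
  [ffun i => if unlift ord_max i is Some j then f j else qn].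

Variable g2 : nat -> {set 'I_n}.

Lemma updl_rk (t : #|Q|.-tuple {set 'I_n}) q : updl g2 0 t (rk q) = tnth t (enum_rank q).
Proof. by rewrite /updl size_tuple /= ltn_ord subn0 (tnth_nth (g2 (rk q))). Qed.

Lemma in_state_tuple f q i : in_state (updl g2 0 (states_tuple f)) q i = (q == f i).
Proof.
apply/forallP/eqP => [/(_ (f i))|-> q'].
  by rewrite updl_rk tnth_mktuple inE enum_rankK eqxx eq_sym => /eqP/eqP.
by rewrite updl_rk tnth_mktuple inE enum_rankK [f i == _]eq_sym.
Qed.

Lemma states_tuple_inj : injective states_tuple.
Proof.
move=> f f' e; apply/ffunP => i; apply/eqP.
by rewrite -(in_state_tuple f') -e in_state_tuple.
Qed.

Lemma run_of_widen qn f (i : 'I_n) : run_of qn f (widen_ord (leqnSn n) i) = f i.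
Proof.
have -> : widen_ord (leqnSn n) i = lift ord_max i by apply: val_inj; rewrite [RHS]lift_max.
by rewrite ffunE liftK.
Qed.

Lemma next_state_tuple qn f q i :
  next_state (updl g2 0 (states_tuple f)) qn q i = (q == run_of qn f (lift ord0 i)).
Proof.
have := ltn_ord i; rewrite leq_eqVlt => /orP[/eqP e|h].
  have -> : lift ord0 i = ord_max :> 'I_n.+1 by apply: val_inj; rewrite [LHS]lift0 e.
  rewrite ffunE unlift_none /next_state e eqxx andbT.
  case: existsP => // -[j /andP[/eqP ej]]; have := ltn_ord j.
  by rewrite [nat_of_ord j]ej ltnn.
have -> : lift ord0 i = widen_ord (leqnSn n) (Ordinal h) by apply: val_inj.
rewrite run_of_widen /next_state (ltn_eqF h) andbF orbF.
apply/existsP/eqP => [[j /andP[/eqP ej]]|->].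
  rewrite in_state_tuple => /eqP->; congr (f _); exact: val_inj.
by exists (Ordinal h); rewrite in_state_tuple !eqxx.
Qed.

Lemma weight_at_tuple qn f i : weight_at (updl g2 0 (states_tuple f)) qn i =
  pos_weight dcall dint dret (run_of qn f) i.
Proof.
rewrite /weight_at (sum_indicator (i0 := f i)); last first.
  by move=> q; rewrite in_state_tuple.
rewrite (sum_indicator (i0 := run_of qn f (lift ord0 i))); last first.
  by move=> q; rewrite next_state_tuple.
rewrite (sum_indicator (i0 := tnth (nw_word nw) i)); last first.
  by move=> a; rewrite /= eq_sym.
rewrite /pos_weight run_of_widen; case: pickP => [j ji|nr].
  rewrite (sum_indicator (i0 := f j)) => [|q] /=.
    by rewrite run_of_widen ifF ?mul0r ?addr0 //; apply/negbF/existsP; exists j.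
  apply/existsP/eqP => [[k /andP[ki]]|->].
    by rewrite in_state_tuple (nest_funl (nw_nest nw) ki ji) => /eqP.
  by exists j; rewrite ji in_state_tuple eqxx.
rewrite big1 ?add0r => [|q _]; last first.
  rewrite ifF ?mul0r //; apply/existsP => -[k]; by rewrite nr.
rewrite ifT ?mul1r; last by apply/existsPn => k; rewrite nr.
by case: ifP; rewrite mul1r mul0r ?addr0 ?add0r.
Qed.

Lemma first_state_tuple f q :
  first_state (updl g2 0 (states_tuple f)) q = (q == f (Ordinal (nw_pos nw))).
Proof.
apply/existsP/eqP => [[i /andP[/eqP i0]]|->].
  rewrite in_state_tuple => /eqP->; congr (f _); exact: val_inj.
by exists (Ordinal (nw_pos nw)); rewrite in_state_tuple !eqxx.
Qed.

(** If every position is in exactly one state set, the tuple comes from a function; otherwise some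
    position satisfies no [in_state], and its factor is 0. *)
Lemma weight_at_invalid qn (t : #|Q|.-tuple {set 'I_n}) :
  t \notin [set states_tuple f | f in {: {ffun 'I_n -> Q}}] ->
  \prod_(i < n) weight_at (updl g2 0 t) qn i = 0.
Proof.
move=> nt; have [/existsP[i /existsPn ni]|/existsPn h] :=
    boolP [exists i, ~~ [exists q, in_state (updl g2 0 t) q i]].
  rewrite (bigD1 i) //= {1}/weight_at big1 ?mul0r // => q _.
  by rewrite (negbTE (ni q)) mul0r.
have {}h i : exists q, in_state (updl g2 0 t) q i by have := h i; rewrite negbK => /existsP.
case/negP: nt; apply/imsetP; exists [ffun i => xchoose (h i)] => //.
apply: eq_from_tnth => k; rewrite tnth_mktuple; apply/setP => i; rewrite inE ffunE.
have /forallP/(_ (enum_val k)) := xchooseP (h i).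
by rewrite updl_rk enum_valK eq_sym [_ == enum_val k]eq_sym => /eqP.
Qed.

Lemma sum_run_weight :
  \sum_(t : #|Q|.-tuple {set 'I_n}) run_weight (updl g2 0 t) =
  behavior iota0 kappa dcall dint dret nw.
Proof.
rewrite exchange_big /=.
transitivity (\sum_qn \sum_(f : {ffun 'I_n -> Q})
   iota0 (run_of qn f ord0) *
   (\prod_(i < n) pos_weight dcall dint dret (run_of qn f) i) * kappa (run_of qn f ord_max)).
  apply: eq_bigr => qn _.
  rewrite (bigID (mem [set states_tuple f | f in {: {ffun 'I_n -> Q}}])) /=.
  rewrite [X in _ + X]big1 ?addr0 => [|t nt]; last by rewrite weight_at_invalid // mulr0.
  rewrite big_imset /=; last by move=> ? ? _ _ /states_tuple_inj.
  apply: eq_bigr => f _; rewrite (eq_bigr _ (fun i _ => weight_at_tuple qn f i)).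
  rewrite (sum_indicator (i0 := f (Ordinal (nw_pos nw)))); last first.
    by move=> q; rewrite first_state_tuple.
  rewrite (_ : ord0 = widen_ord (leqnSn n) (Ordinal (nw_pos nw))); last exact: val_inj.
  by rewrite run_of_widen [run_of _ _ ord_max]ffunE unlift_none -mulrA mulrC.
(* A run is the same as its last state together with the states before the positions. *)
rewrite pair_big /= (reindex (fun r : {ffun 'I_n.+1 -> Q} =>
    (r ord_max, [ffun i : 'I_n => r (lift ord_max i)]))) /=.
  apply: eq_bigr => r _; rewrite (_ : run_of _ _ = r) //.
  by apply/ffunP => i; rewrite ffunE; case: unliftP => [j ->|->]; rewrite ?ffunE.
exists (fun p => run_of p.1 p.2) => [r _|[qn f] _] /=.
  by apply/ffunP => i; rewrite ffunE; case: unliftP => [j ->|->]; rewrite ?ffunE.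
congr (_, _); first by rewrite ffunE unlift_none.
by apply/ffunP => i; rewrite !ffunE liftK.
Qed.
End Runs.

Lemma behavior_sREMSO : definable (@sREMSO Delta K) (behavior iota0 kappa dcall dint dret).
Proof.
have [psi [fo s1 s2 sem]] := rdef_run_weight.
have fv Xs : wfv1 (foldr WExS psi Xs) = wfv1 psi.
  by elim: Xs.
have fv2 Xs u : u \in wfv2 (foldr WExS psi Xs) -> (u \in wfv2 psi) && (u \notin Xs).
  elim: Xs => [|X Xs IH] /=; first by rewrite andbT.
  by rewrite mem_filter /= inE negb_or => /andP[-> /IH].
have nil (s : seq nat) : {subset s <= [::]} -> s = [::].
  by case: s => // u s /(_ u (mem_head _ _)).
exists (foldr WExS psi V2); split; first by exists V2, psi.
  split; first by rewrite fv; apply: nil.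
  by apply: nil => u /fv2 /andP[/s2 ->].
move=> nw; rewrite /sentence_sem wsem_foldr_exists -(sum_run_weight (fun=> set0)).
by apply: eq_bigr => t _; rewrite sem.
Qed.
End AutomatonToFormula.

Lemma regular_sREMSO (Delta : finType) (K : comPzSemiRingType) (S : nested_word Delta -> K) :
  regular S -> definable (@sREMSO Delta K) S.
Proof.
case=> Q [i [dc [di [dr [k hS]]]]]; have [phi [h1 h2 h3]] := behavior_sREMSO i k dc di dr.
by exists phi; split=> // nw; rewrite h3.
Qed.

Lemma sREMSO_sRMSO Delta K (phi : wform Delta K) : sREMSO phi -> sRMSO phi.
Proof. by case=> Xs [psi [[h _] ->]]; elim: Xs. Qed.

Lemma aUMSO_wUMSO Delta K (phi : wform Delta K) : aUMSO phi -> wUMSO phi.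
Proof.
elim=> {phi} [k|phi h|a b _ ? _ ?|a b _ ? _ ?];
  [exact: wU_const|exact: wU_su|exact: wU_and|exact: wU_or].
Qed.

Lemma restricted_sub Delta K (P R : wform Delta K -> Prop) phi :
  (forall psi, P psi -> R psi) -> restricted P phi -> restricted R phi.
Proof.
move=> PR; elim: phi => //= [a IHa b IHb|a IHa b IHb|x a IH|X a IH];
  by case=> *; split; auto.
Qed.

Theorem theorem3p6 (Delta : finType) (K : comPzSemiRingType)
    (H01 : (0 : K)%R != 1%R) (S : nested_word Delta -> K) :
  [/\ (regular S <-> definable (@sRMSO Delta K) S),
      (definable (@sRMSO Delta K) S <-> definable (@sREMSO Delta K) S),
      (add_loc_finite K -> (regular S <-> definable (@swRMSO Delta K) S)) &
      (loc_finite K -> (regular S <-> definable (@MSO Delta K) S))].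
Proof.
have sub : definable (@sREMSO Delta K) S -> definable (@sRMSO Delta K) S.
  by case=> phi [h1 h2 h3]; exists phi; split=> //; apply: sREMSO_sRMSO.
have rs : regular S -> definable (@sRMSO Delta K) S by move/regular_sREMSO/sub.
have sr : definable (@sRMSO Delta K) S -> regular S.
  case=> phi [h1 h2 h3]; apply: wregrep_regular h2 h3.
  exact: restricted_wregrep (@aUMSO_finrep _ _) h1.
split.
- by split.
- by split=> // /sr/regular_sREMSO.
- move=> lf; split=> [/rs[phi [h1 h2 h3]]|[phi [h1 h2 h3]]].
    by exists phi; split=> //; apply: restricted_sub h1; apply: aUMSO_wUMSO.
  by apply: wregrep_regular h2 h3; apply: restricted_wregrep (wUMSO_finrep lf) h1.
- move=> lf; split=> [/rs[phi [h1 h2 h3]]|[phi [h1 h2 h3]]]; first by exists phi.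
  by apply: wregrep_regular h2 h3; apply/finrep_wregrep/loc_finite_finrep.
Qed.
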